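(* Let $p\in(0,1)$ and $\lambda>0$ be fixed. There exists a constant $C>0$ such that, for $d$ large enough, $$\limsup_{n\to\infty}\frac1n\Big|I(\mathbf X,\mathbf G)-I(\tilde{\mathbf X},\mathbf Y)\Big|\le C\sqrt{\frac{\lambda}{d}}.$$
   Context: **Graph model.** For $d>0$ let $\epsilon=\sqrt{\lambda/d}$, $a=1+\frac{1-p}{p}\epsilon$, $b=1-\epsilon$, $c=1+\frac{p}{1-p}\epsilon$ and $M=\frac dn\begin{pmatrix} a & b \\ b & c \end{pmatrix}$ ($d$, then $n$, large enough that entries of $M$ lie in $[0,1]$). Labels $X_1,\dots,X_n\in\{1,2\}$ are i.i.d. with $\mathbb{P}(X_i=1)=p$; conditionally on $\mathbf X=(X_1,\dots,X_n)$ the edge indicators $G_{i,j}$, $1\le i<j\le n$, are independent Bernoulli variables with means $M_{X_i,X_j}$; $\mathbf G=(G_{i,j})_{i<j}$. **Gaussian channel.** Let $\phi_p(1)=\sqrt{\frac{1-p}{p}}$, $\phi_p(2)=-\sqrt{\frac{p}{1-p}}$, $\tilde X_i=\phi_p(X_i)$, $\tilde{\mathbf X}=(\tilde X_1,\dots,\tilde X_n)$, and $Y_{i,j}=\sqrt{\lambda/n}\,\tilde X_i\tilde X_j+Z_{i,j}$ for $1\le i<j\le n$, with $Z_{i,j}\overset{i.i.d.}{\sim}\mathcal N(0,1)$ independent of everything else; $\mathbf Y=(Y_{i,j})_{i<j}$. $I(\cdot,\cdot)$ is mutual information (natural logarithm). *)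

(* Defs.v *)
From HB Require Import structures.
From mathcomp Require Import all_boot all_order all_algebra.
From mathcomp Require Import all_classical all_reals all_analysis.
From mathcomp Require Import measurable_realfun.

Set Implicit Arguments.
Unset Strict Implicit.
Unset Printing Implicit Defensive.

Import Order.TTheory GRing.Theory Num.Theory.
Import numFieldNormedType.Exports.

Local Open Scope classical_set_scope.
Local Open Scope ring_scope.

Section random_elements.
Context d (Om : measurableType d).

(* A finite family of random elements as one random element, the index type [I]
   being enumerated by ['I_#|I|]. *)
Definition joint d' (T : measurableType d') (I : finType)
    (F : I -> {mfun Om >-> T}) (w : Om) : #|I|.-tuple T :=
  [tuple F (enum_val k) w | k < #|I|].

Lemma measurable_joint d' (T : measurableType d') (I : finType)
  (F : I -> {mfun Om >-> T}) : measurable_fun setT (joint F).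
Proof.
apply/measurable_fun_tnthP => k.
rewrite (_ : _ \o _ = F (enum_val k)); first exact: measurable_funPT.
by apply/funext => w; rewrite /= tnth_mktuple.
Qed.

HB.instance Definition _ d' (T : measurableType d') (I : finType)
    (F : I -> {mfun Om >-> T}) :=
  isMeasurableFun.Build _ _ _ _ (joint F) (measurable_joint F).

Definition pairing d1 d2 (T1 : measurableType d1) (T2 : measurableType d2)
  (X : {mfun Om >-> T1}) (Y : {mfun Om >-> T2}) (w : Om) : T1 * T2 := (X w, Y w).

Lemma measurable_pairing d1 d2 (T1 : measurableType d1) (T2 : measurableType d2)
  (X : {mfun Om >-> T1}) (Y : {mfun Om >-> T2}) :
  measurable_fun setT (pairing X Y).
Proof. by apply: measurable_fun_pair; exact: measurable_funPT. Qed.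

HB.instance Definition _ d1 d2 (T1 : measurableType d1)
    (T2 : measurableType d2) (X : {mfun Om >-> T1}) (Y : {mfun Om >-> T2}) :=
  isMeasurableFun.Build _ _ _ _ (pairing X Y) (measurable_pairing X Y).

End random_elements.

Section probability_notions.
Context (R : realType).

(* Only measurable sets are compared: the values of a [probability] on other
   sets are meaningless. *)
Definition has_law d d' (Om : measurableType d) (T : measurableType d')
    (P : probability Om R) (X : {RV P >-> T}) (mu : set T -> \bar R) : Prop :=
  forall A : set T, measurable A -> distribution P X A = mu A.

Definition independent d d' (Om : measurableType d) (T : measurableType d')
    (P : probability Om R) (I : finType) (F : I -> {RV P >-> T}) : Prop :=
  forall B : I -> set T, (forall i, measurable (B i)) ->
    P (\bigcap_i (F i @^-1` B i)) = (\prod_(i : I) P (F i @^-1` B i))%E.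

Definition iid d d' (Om : measurableType d) (T : measurableType d')
    (P : probability Om R) (I : finType) (F : I -> {RV P >-> T})
    (mu : set T -> \bar R) : Prop :=
  independent F /\ forall i, has_law (F i) mu.

Definition independent2 d d1 d2 (Om : measurableType d)
    (T1 : measurableType d1) (T2 : measurableType d2) (P : probability Om R)
    (X : {RV P >-> T1}) (Y : {RV P >-> T2}) : Prop :=
  forall (A : set T1) (B : set T2), measurable A -> measurable B ->
    P (X @^-1` A `&` Y @^-1` B) = (P (X @^-1` A) * P (Y @^-1` B))%E.

Definition relative_entropy d (T : measurableType d)
    (mu nu : probability T R) : \bar R :=
  if `[< mu `<< nu >] then
    (\int[mu]_x lne (Radon_Nikodym (charge_of_finite_measure mu) nu x))%E
  else +oo%E.

Definition mutual_info d d1 d2 (Om : measurableType d)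
    (T1 : measurableType d1) (T2 : measurableType d2) (P : probability Om R)
    (X : {RV P >-> T1}) (Y : {RV P >-> T2}) : \bar R :=
  relative_entropy (distribution P (pairing X Y))
                   (distribution P X \x distribution P Y)%E.

End probability_notions.

Definition edge (n : nat) : finType :=
  {e : 'I_n * 'I_n | (e.1 < e.2)%N}.

(* A label is a boolean: [true] is the label 1, [false] the label 2. *)
Section models.
Context (R : realType) (p lambda : R).

Definition sbm_matrix (d : R) (n : nat) (x y : bool) : R :=
  let eps := Num.sqrt (lambda / d) in
  d / n%:R * match x, y with
             | true, true => 1 + (1 - p) / p * eps
             | false, false => 1 + p / (1 - p) * eps
             | _, _ => 1 - eps
             end.

(* The conditional law of the edges given the labels is expressed through the
   joint probabilities P(X = x, G = g) = P(X = x) P(G = g | X = x).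
   [bernoulli_prob q] is the Dirac mass at [false] when [q] is not in [0, 1];
   this does not occur once lambda <= d and n is large. *)
Definition sbm (d : R) (n : nat) dO (Om : measurableType dO)
    (P : probability Om R)
    (X : 'I_n -> {RV P >-> bool}) (G : edge n -> {RV P >-> bool}) : Prop :=
  iid X (bernoulli_prob p) /\
  forall (x : 'I_n -> bool) (g : edge n -> bool),
    let labels := [set w | forall i, X i w = x i] in
    let edges := [set w | forall e, G e w = g e] in
    P (labels `&` edges) =
    (P labels * \prod_(e : edge n)
       bernoulli_prob (sbm_matrix d n (x (val e).1) (x (val e).2)) [set g e])%E.

Definition phi (x : bool) : R :=
  if x then Num.sqrt ((1 - p) / p) else - Num.sqrt (p / (1 - p)).

Section channel.
Context dO (Om : measurableType dO).

Definition spin (X : {mfun Om >-> bool}) (w : Om) : R := phi (X w).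

Lemma measurable_spin (X : {mfun Om >-> bool}) : measurable_fun setT (spin X).
Proof. by apply: (measurableT_comp (f := phi)). Qed.

HB.instance Definition _ (X : {mfun Om >-> bool}) :=
  isMeasurableFun.Build _ _ _ _ (spin X) (measurable_spin X).

Definition observation n (X : 'I_n -> {mfun Om >-> bool})
    (Z : edge n -> {mfun Om >-> R}) (e : edge n) (w : Om) : R :=
  Num.sqrt (lambda / n%:R) * spin (X (val e).1) w * spin (X (val e).2) w + Z e w.

Lemma measurable_observation n (X : 'I_n -> {mfun Om >-> bool})
    (Z : edge n -> {mfun Om >-> R}) (e : edge n) :
  measurable_fun setT (observation X Z e).
Proof.
apply: measurable_funD; last exact: measurable_funPT.
by apply: measurable_funM; [apply: measurable_funM => //|];
  exact: measurable_spin.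
Qed.

HB.instance Definition _ n (X : 'I_n -> {mfun Om >-> bool})
    (Z : edge n -> {mfun Om >-> R}) (e : edge n) :=
  isMeasurableFun.Build _ _ _ _ (observation X Z e)
    (measurable_observation X Z e).

End channel.

Definition gaussian_noise (n : nat) dO (Om : measurableType dO)
    (P : probability Om R) (X : 'I_n -> {RV P >-> bool})
    (G : edge n -> {RV P >-> bool}) (Z : edge n -> {RV P >-> R}) : Prop :=
  iid Z (normal_prob 0 1) /\
  independent2 (P := P) (pairing (joint X) (joint G)) (joint Z).

Definition graph_info (n : nat) dO (Om : measurableType dO)
    (P : probability Om R) (X : 'I_n -> {RV P >-> bool})
    (G : edge n -> {RV P >-> bool}) : \bar R :=
  mutual_info (P := P) (joint X) (joint G).

Definition channel_info (n : nat) dO (Om : measurableType dO)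
    (P : probability Om R) (X : 'I_n -> {RV P >-> bool})
    (Z : edge n -> {RV P >-> R}) : \bar R :=
  mutual_info (P := P) (joint (fun i => spin (X i)))
                       (joint (observation X Z)).

End models.

(* Main.v *)
(* Conditionally on the labels the edge observations are independent, so with
   h(w) = (sum w) ln (sum w) - sum w ln w each mutual information equals
   H(X) - E h(posterior weights), and H(X) cancels in the difference. The Gaussian
   observations are exchanged one at a time for Bernoulli ones.
   Whatever weights w the other observations put on the labels, observing one edge
   decreases E h by (lambda / 2n) Var_w(s), where s is the product of the two spins
   of that edge, up to O(eps / n + d / n^2) times the mass of w in the Bernoulli
   case (third order Taylor expansion of (1 + u) ln (1 + u)) and up to O(1 / n^2)
   in the Gaussian case.
   Summing over the at most n^2 edges gives n * O(eps) + O(1). *)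

Require Import Defs.
From HB Require Import structures.
From mathcomp Require Import all_boot all_order all_algebra.
From mathcomp Require Import all_classical all_reals all_analysis.
From mathcomp Require Import ring lra measurable_realfun.

Set Implicit Arguments.
Unset Strict Implicit.
Unset Printing Implicit Defensive.

Import Order.TTheory GRing.Theory Num.Theory.
Import numFieldNormedType.Exports.

Local Open Scope classical_set_scope.
Local Open Scope ring_scope.

(** * Entropy and Bernoulli observations *)

(** The edge probabilities are [q * (1 + eps * s)] with [q = d / n] and the Gaussian means are
    [a * s] with [a ^+ 2 = lambda / n], for the same product [s] of two spins. Since
    [q * eps ^+ 2 = a ^+ 2], the two kinds of observation agree to second order under every prior.
    Weights stay unnormalised because [ent] is homogeneous of degree one: an expected posterior
    entropy is then a plain sum or integral of [ent] over the outcomes, with no division by their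
    probabilities. An error proportional to the mass survives all other observations unchanged,
    since the masses of the outcomes add up to the mass before; the exchange errors therefore add
    instead of compounding. The Gaussian log-likelihood is unbounded, so expanding the integrand
    would not give a uniform remainder. Instead the mixture is compared with one Gaussian of the
    same mean: the relative entropy lies between 0 and the chi-square divergence, and the latter is
    explicit. *)

Section entropy.
Context (R : realType).
Implicit Types t u : R.

(** With [xlnx_le] this traps [t * ln (t / u)] between [t - u] and the chi-square integrand
    [t * (t / u - 1)]. Both come from [ln (1 + x) <= x], and the only logarithm left in the bounds
    is that of the reference [u]. *)
Lemma xlnx_ge t u : 0 < t -> 0 < u -> t * ln u + t - u <= t * ln t.
Proof.
move=> t0 u0.
have : ln (1 + (u / t - 1)) <= u / t - 1.
  by apply: le_ln1Dx; rewrite ltrBrDl subrr divr_gt0.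
rewrite addrC subrK ln_div ?posrE// -(ler_pM2l t0) !mulrBr mulr1.
by rewrite mulrCA divff ?gt_eqF// mulr1; lra.
Qed.

Lemma xlnx_le t u : 0 < t -> 0 < u -> t * ln t <= t * ln u + t * (t / u - 1).
Proof.
move=> t0 u0; rewrite -mulrDr ler_pM2l//.
have : ln (1 + (t / u - 1)) <= t / u - 1.
  by apply: le_ln1Dx; rewrite ltrBrDl subrr divr_gt0.
by rewrite addrC subrK ln_div ?posrE//; lra.
Qed.

Lemma is_derive_xlnx t : 0 < 1 + t ->
  is_derive t 1 (fun x : R => (1 + x) * ln (1 + x) - x - x ^+ 2 / 2)
    (ln (1 + t) - t).
Proof.
move=> t0.
have d1 : is_derive t 1 (cst 1 + id : R -> R) 1.
  by apply: is_derive_eq; rewrite add0r.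
have dl : is_derive t 1 (fun x : R => ln (1 + x)) (1 + t)^-1.
  have := @is_derive1_comp R (@ln R) (cst 1 + id) t _ _ (is_derive1_ln t0) d1.
  by rewrite mulr1.
have dM : is_derive t 1 ((cst 1 + id : R -> R) * (fun x : R => ln (1 + x)) - id
    - 2^-1 *: (@id R ^+ 2)) (ln (1 + t) - t).
  apply: is_derive_eq; rewrite /GRing.scale /= expr1.
  have : (cst 1 + id : R -> R) t = 1 + t by [].
  move=> ->; field; lra.
suff -> : (fun x : R => (1 + x) * ln (1 + x) - x - x ^+ 2 / 2) =
    (cst 1 + id : R -> R) * (fun x : R => ln (1 + x)) - id
    - 2^-1 *: (@id R ^+ 2) by [].
by apply/funext => x; rewrite !fctE /= [X in _ - X = _]mulrC.
Qed.

(** One use of the mean value theorem suffices: the remainder vanishes at 0 and its derivative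
    [ln (1 + x) - x] is at most [2 * u ^+ 2] in absolute value between 0 and [u]. *)
Lemma xlnx_taylor u : `|u| <= 2^-1 ->
  `|(1 + u) * ln (1 + u) - u - u ^+ 2 / 2| <= 2 * `|u| ^+ 3.
Proof.
move=> u2; pose f (x : R) := (1 + x) * ln (1 + x) - x - x ^+ 2 / 2.
have f0 : f 0 = 0 by rewrite /f addr0 ln1 mulr0 expr0n/= mul0r !subr0.
have df (x : R) : `|x| <= 2^-1 -> is_derive x 1 f (ln (1 + x) - x).
  by move=> xl; apply: is_derive_xlnx; move: xl; rewrite ler_norml; lra.
have cf (a b : R) : - 2^-1 <= a -> b <= 2^-1 -> {within `[a, b], continuous f}.
  move=> a2 b2; apply: derivable_within_continuous => x /itvP xab.
  have /df[] // : `|x| <= 2^-1 by rewrite ler_norml !(le_trans a2, le_trans _ b2) ?xab.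
have b (x : R) : `|x| <= `|u| -> `|ln (1 + x) - x| <= 2 * `|u| ^+ 2.
  move=> xu; have x2 := le_trans xu u2.
  have x0 : 0 < 1 + x by move: x2; rewrite ler_norml; lra.
  have l1 : ln (1 + x) <= x by apply: le_ln1Dx; lra.
  have l2 : x - x ^+ 2 / (1 + x) <= ln (1 + x).
    have : ln (1 + ((1 + x)^-1 - 1)) <= (1 + x)^-1 - 1.
      by apply: le_ln1Dx; rewrite ltrBrDl subrr invr_gt0.
    rewrite [1 + (_ - 1)]addrC subrK lnV ?posrE//.
    have -> : (1 + x)^-1 - 1 = - (x - x ^+ 2 / (1 + x)) by field; lra.
    by rewrite lerN2.
  have l3 : x ^+ 2 / (1 + x) <= 2 * `|u| ^+ 2.
    rewrite ler_pdivrMr// -[x ^+ 2]real_normK ?num_real//.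
    have : `|x| ^+ 2 <= `|u| ^+ 2 by rewrite lerXn2r ?nnegrE.
    have : 2^-1 <= 1 + x by move: x2; rewrite ler_norml; lra.
    have : 0 <= `|u| ^+ 2 by [].
    nra.
  by rewrite ler0_norm ?subr_le0//; lra.
rewrite -/(f u) exprS mulrCA.
have [u0|u0|->] := ltgtP u 0; last by rewrite f0 !normr0 !mul0r.
- have nu : `|u| = - u by rewrite ltr0_norm.
  have [] := @MVT R f (fun x => ln (1 + x) - x) u 0 u0.
  + move=> x /itvP xu; apply: df; rewrite (le_trans _ u2)// nu ler0_norm ?xu//.
    by rewrite lerN2 xu.
  + by apply: cf => //; move: u2; rewrite ler_norml => /andP[].
  + move=> c /itvP cu; rewrite f0 sub0r sub0r => fE.
    rewrite -normrN fE normrM normrN mulrC ler_wpM2l// b// nu ler0_norm ?xu//.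
      by rewrite lerN2 cu.
    by rewrite cu.
- have nu : `|u| = u by rewrite gtr0_norm.
  have [] := @MVT R f (fun x => ln (1 + x) - x) 0 u u0.
  + by move=> x /itvP xu; apply: df; rewrite (le_trans _ u2)// nu ger0_norm ?xu.
  + by apply: cf => //; move: u2; rewrite ler_norml => /andP[].
  + move=> c /itvP cu; rewrite f0 !subr0 => fE.
    by rewrite fE normrM mulrC ler_wpM2l// b// nu ger0_norm ?cu.
Qed.

End entropy.

Section discrete.
Context (R : realType).

(* relative entropy of Bernoulli(q (1 + u)) with respect to Bernoulli(q) *)
Definition bern_div (q u : R) : R :=
  q * ((1 + u) * ln (1 + u)) + (1 - q * (1 + u)) * ln (1 - q / (1 - q) * u).

(** An absent edge has probability [(1 - q) * (1 + v)] with [q * u + (1 - q) * v = 0], so the linear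
    Taylor terms cancel. Its quadratic term is at most [q ^+ 2 * u ^+ 2] and its cubic remainder at
    most twice that, whence [3 * q]; the term [2 * |u|] is the remainder of a present edge. *)
Lemma bern_div_approx (q u : R) : 0 < q <= 2^-1 -> `|u| <= 2^-1 ->
  `|bern_div q u - q * u ^+ 2 / 2| <= q * u ^+ 2 * (2 * `|u| + 3 * q).
Proof.
move=> /andP[q0 q2] u2; set v := - (q / (1 - q) * u).
have vu : `|v| <= 2 * q * `|u|.
  have q1 : 0 < 1 - q by lra.
  rewrite normrN normrM ler_wpM2r// gtr0_norm ?divr_gt0// ler_pdivrMr//; nra.
have v2 : `|v| <= 2^-1 by apply: (le_trans vu); have := normr_ge0 u; nra.
have := xlnx_taylor u2; have := xlnx_taylor v2.
set ev := (1 + v) * _ - _ - _; set eu := (1 + u) * _ - _ - _ => hv hu.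
have -> : bern_div q u - q * u ^+ 2 / 2 =
    q * eu + (q ^+ 2 * u ^+ 2 / (2 * (1 - q)) + (1 - q) * ev).
  have E : 1 - q / (1 - q) * u = 1 + v by [].
  rewrite /bern_div E /ev /eu (_ : 1 - q * (1 + u) = (1 - q) * (1 + v)).
    by rewrite /v; field; lra.
  by rewrite /v; field; lra.
have nu2 : u ^+ 2 = `|u| ^+ 2 by rewrite real_normK ?num_real.
have v3 : (1 - q) * (2 * `|v| ^+ 3) <= 2 * q ^+ 2 * u ^+ 2.
  have E : (1 - q) * `|v| ^+ 2 = q ^+ 2 / (1 - q) * u ^+ 2.
    by rewrite real_normK ?num_real// /v; field; lra.
  have E1 : q ^+ 2 / (1 - q) <= 2 * q ^+ 2 by rewrite ler_pdivrMr; nra.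
  have E2 : (1 - q) * `|v| ^+ 2 <= 2 * q ^+ 2 * u ^+ 2.
    by rewrite E ler_wpM2r// sqr_ge0.
  have E0 : 0 <= (1 - q) * `|v| ^+ 2 by rewrite mulr_ge0//; lra.
  have -> : (1 - q) * (2 * `|v| ^+ 3) = 2 * `|v| * ((1 - q) * `|v| ^+ 2) by ring.
  nra.
have q2u : 0 <= q ^+ 2 * u ^+ 2 / (2 * (1 - q)) <= q ^+ 2 * u ^+ 2.
  have p0 : 0 <= q ^+ 2 * u ^+ 2 by rewrite mulr_ge0 ?sqr_ge0.
  rewrite divr_ge0//=; last lra.
  by rewrite ler_pdivrMr; nra.
have hv' : `|(1 - q) * ev| <= 2 * q ^+ 2 * u ^+ 2.
  by rewrite normrM ger0_norm; [apply: le_trans v3; rewrite ler_wpM2l//|]; lra.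
have hu' : `|q * eu| <= q * (2 * `|u| ^+ 3) by rewrite normrM gtr0_norm// ler_wpM2l// ltW.
have E3 : q * (2 * `|u| ^+ 3) = q * u ^+ 2 * (2 * `|u|) by rewrite nu2; ring.
rewrite E3 in hu'.
move: hu' hv'; rewrite !ler_norml; move/andP: q2u; lra.
Qed.

Context (F : finType).
Implicit Types w u : F -> R.

(* If X has unnormalised law w then [ent w] is its total mass times the Shannon entropy of X *)
Definition ent w : R :=
  (\sum_x w x) * ln (\sum_x w x) - \sum_x w x * ln (w x).

Lemma entE w : ent w = \sum_x w x * (ln (\sum_x w x) - ln (w x)).
Proof.
rewrite /ent mulr_suml -sumrB; apply: eq_bigr => x _.
by rewrite mulrBr.
Qed.

Lemma ent_ge0 w : (forall x, 0 < w x) -> 0 <= ent w.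
Proof.
move=> w0; rewrite entE sumr_ge0// => x _.
have wx : w x <= \sum_x w x.
  by rewrite (bigD1 x)//= lerDl sumr_ge0// => y _; exact: ltW.
rewrite mulr_ge0 ?subr_ge0 ?ler_ln ?posrE ?w0 ?(lt_le_trans _ wx)//.
exact: ltW.
Qed.

Definition mean w u : R := (\sum_x w x * u x) / \sum_x w x.

Lemma mean_norm w u (U : R) : (forall x, 0 < w x) -> 0 < \sum_x w x ->
  (forall x, `|u x| <= U) -> `|mean w u| <= U.
Proof.
move=> w0 W0 uU; rewrite normrM normfV (gtr0_norm W0) ler_pdivrMr//.
rewrite (le_trans (ler_norm_sum _ _ _))// mulr_sumr ler_sum// => x _.
by rewrite normrM gtr0_norm// mulrC ler_wpM2r// ltW.
Qed.

(** The total mass times the variance of [u] under the normalised weights. *)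
Definition variance w u : R :=
  \sum_x w x * u x ^+ 2 - (\sum_x w x) * mean w u ^+ 2.

(** The entropy lost is the information carried by the edge. By the compensation identity it is the
    average divergence from the reference Bernoulli(q), minus the divergence of the mixture, which
    is again of the form Bernoulli(q (1 + m)) with [m] the mean of [u]. *)
Lemma ent_bernE w u (q : R) : (forall x, 0 < w x) -> 0 < \sum_x w x ->
  0 < q <= 2^-1 -> (forall x, `|u x| <= 2^-1) ->
  ent (fun x => w x * (q * (1 + u x))) + ent (fun x => w x * (1 - q * (1 + u x)))
  = ent w + ((\sum_x w x) * bern_div q (mean w u)
             - \sum_x w x * bern_div q (u x)).
Proof.
move=> w0 W0 /andP[q0 q2] u2; set W := \sum_x w x; set m := mean w u.
have m2 : `|m| <= 2^-1 by apply: mean_norm.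
have pos1 (z : R) : `|z| <= 2^-1 -> 0 < 1 + z by rewrite ler_norml; lra.
have posv (z : R) : `|z| <= 2^-1 -> 0 < 1 - q / (1 - q) * z.
  move=> z2; rewrite subr_gt0 mulrAC ltr_pdivrMr ?mul1r; last lra.
  by move: z2; rewrite ler_norml; nra.
have qE (z : R) : 1 - q * (1 + z) = (1 - q) * (1 - q / (1 - q) * z).
  by field; lra.
have S1 : \sum_x w x * (q * (1 + u x)) = W * (q * (1 + m)).
  rewrite (eq_bigr (fun x => q * w x + q * (w x * u x))); last by move=> x _; ring.
  rewrite big_split/= -!mulr_sumr /m /mean -/W; by field; rewrite gt_eqF.
have S2 : \sum_x w x * (1 - q * (1 + u x)) = W * (1 - q * (1 + m)).
  rewrite (eq_bigr (fun x => w x - w x * (q * (1 + u x)))); last by move=> x _; ring.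
  by rewrite sumrB S1 -/W; ring.
rewrite !entE S1 S2 -[LHS]big_split/= /bern_div -/W.
have lnW1 : ln (W * (q * (1 + m))) = ln W + ln q + ln (1 + m).
  by rewrite !lnM ?posrE ?mulr_gt0 ?pos1// addrA.
have lnW2 : ln (W * (1 - q * (1 + m))) = ln W + ln (1 - q) + ln (1 - q / (1 - q) * m).
  by rewrite qE !lnM ?posrE ?mulr_gt0 ?posv ?addrA//; lra.
rewrite lnW1 lnW2.
rewrite (eq_bigr (fun x => w x * (ln W - ln (w x))
  + (w x * (q * (1 + u x)) * ln (1 + m)
  + w x * (1 - q * (1 + u x)) * ln (1 - q / (1 - q) * m)
  - w x * bern_div q (u x)))); last first.
  move=> x _; have wx := w0 x.
  have -> : ln (w x * (q * (1 + u x))) = ln (w x) + ln q + ln (1 + u x).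
    by rewrite !lnM ?posrE ?mulr_gt0 ?pos1// addrA.
  have -> : ln (w x * (1 - q * (1 + u x))) =
      ln (w x) + ln (1 - q) + ln (1 - q / (1 - q) * u x).
    by rewrite qE !lnM ?posrE ?mulr_gt0 ?posv ?addrA//; lra.
  rewrite /bern_div; ring.
rewrite big_split/= sumrB big_split/= -!mulr_suml S1 S2.
by rewrite /bern_div; congr (_ + (_ - _)); ring.
Qed.

(** The quadratic parts of the two divergence terms combine into the variance. The factor 2 arises
    because [bern_div_approx] is applied once at the mean and once in the average over labels. *)
Lemma ent_bern_approx w u (q U : R) : (forall x, 0 < w x) ->
  0 < \sum_x w x -> 0 < q <= 2^-1 -> U <= 2^-1 -> (forall x, `|u x| <= U) ->
  `|ent (fun x => w x * (q * (1 + u x)))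
    + ent (fun x => w x * (1 - q * (1 + u x)))
    - (ent w - q / 2 * variance w u)|
  <= (\sum_x w x) * (2 * (q * U ^+ 2 * (2 * U + 3 * q))).
Proof.
move=> w0 W0 q02 U2 uU; have u2 x := le_trans (uU x) U2.
have mU := mean_norm w0 W0 uU.
rewrite ent_bernE//; set W := \sum_x w x; set m := mean w u.
set E := q * U ^+ 2 * _.
have bE z : `|z| <= U -> `|bern_div q z - q * z ^+ 2 / 2| <= E.
  move=> zU; have U0 : 0 <= U := le_trans (normr_ge0 _) zU.
  have /andP[q0 _] := q02.
  apply: (le_trans (bern_div_approx q02 (le_trans zU U2))).
  have zU2 : z ^+ 2 <= U ^+ 2.
    by rewrite -[z ^+ 2]real_normK ?num_real// lerXn2r.
  apply: ler_pM.
  - by rewrite mulr_ge0 ?sqr_ge0 ?ltW//.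
  - by have := normr_ge0 z; lra.
  - by rewrite ler_wpM2l // ltW.
  - lra.
have -> : ent w + (W * bern_div q m - \sum_x w x * bern_div q (u x))
    - (ent w - q / 2 * variance w u) = W * (bern_div q m - q * m ^+ 2 / 2)
    - \sum_x w x * (bern_div q (u x) - q * u x ^+ 2 / 2).
  rewrite /variance -/W -/m.
  rewrite [in RHS](eq_bigr (fun x => w x * bern_div q (u x)
     - q / 2 * (w x * u x ^+ 2))); last by move=> x _; field.
  by rewrite sumrB -mulr_sumr; field.
rewrite (le_trans (ler_normB _ _))//.
have -> : W * (2 * E) = W * E + W * E by ring.
apply: lerD; first by rewrite normrM gtr0_norm// ler_wpM2l ?bE// ltW.
rewrite (le_trans (ler_norm_sum _ _ _))// mulr_suml ler_sum// => x _.
by rewrite normrM gtr0_norm// ler_wpM2l ?bE// ltW.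
Qed.

End discrete.

(** * Gaussian observations *)

Section density.
Context d (T : measurableType d) (R : realType).
Variables (nu : {finite_measure set T -> \bar R})
          (rho : {sigma_finite_measure set T -> \bar R}) (w : T -> R).
Hypothesis mw : measurable_fun setT w.
Hypothesis nuE : forall A, measurable A ->
  nu A = (\int[rho]_(x in A) (w x)%:E)%E.

Local Open Scope ereal_scope.

Lemma dominates_density : nu `<< rho.
Proof.
apply/null_content_dominatesP => A mA A0; rewrite nuE//.
apply: null_set_integral => //; apply: measurable_funTS.
exact/measurable_EFinP.
Qed.

(** [w] and the Radon-Nikodym derivative have the same integral over every measurable set, so they
    agree almost everywhere and the change of variables for the derivative carries over. *)
Lemma integral_density (f : T -> \bar R) : measurable_fun setT f ->
  (forall x, 0 <= f x) -> \int[nu]_x f x = \int[rho]_x (f x * (w x)%:E).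
Proof.
move=> mf f0; have dom := dominates_density.
rewrite -(Radon_Nikodym_SigmaFinite.change_of_variables dom)//.
have mRN : measurable_fun setT (Radon_Nikodym_SigmaFinite.f nu rho).
  exact: measurable_int (Radon_Nikodym_SigmaFinite.f_integrable dom).
have mwE : measurable_fun setT (EFin \o w) by exact/measurable_EFinP.
apply: ae_eq_integral => //; [exact: emeasurable_funM|exact: emeasurable_funM|].
apply: ae_eqe_mul2l; apply: integral_ae_eq => //.
  exact: Radon_Nikodym_SigmaFinite.f_integrable.
move=> E _ mE; rewrite -Radon_Nikodym_SigmaFinite.f_integral//.
exact: nuE.
Qed.

End density.

Section translation.
Context (R : realType).
Local Open Scope ereal_scope.

(** Lebesgue measure is determined by its values on half-open intervals, and translation preserves
    their lengths. *)
Lemma lebesgue_measure_translate (c : R) (A : set R) : measurable A ->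
  pushforward lebesgue_measure (+%R^~ c : R -> measurableTypeR R) A
  = lebesgue_measure A.
Proof.
move=> mA; apply/esym/lebesgue_measure_unique => //.
  exact: (@measurable_funD _ _ R).
move=> mc X.
move/ocitvP => [->|[[a b]/= ab ->]]; first by rewrite !measure0.
rewrite /pushforward /=.
have -> : (fun x : R => (x + c)%R) @^-1` `]a, b] = `](a - c)%R, (b - c)%R]%classic.
  by apply/seteqP; split => x /=; rewrite !in_itv/= ltrBlDr lerBrDr.
rewrite !lebesgue_measure_itv/= !lte_fin ltrD2r ab -!EFinD; congr EFin; ring.
Qed.

End translation.

Section std_normal.
Context (R : realType).

Definition to_R (x : measurableTypeR R) : R := x.

Lemma measurable_to_R : measurable_fun setT to_R.
Proof. by move=> _ B mB; rewrite setTI. Qed.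

HB.instance Definition _ := isMeasurableFun.Build _ _ _ _ to_R measurable_to_R.

(* [normal_prob 0 1] is a probability on [measurableTypeR R]; the random
   variables of the model take values in the measurable space [R]. *)
Definition std_normal : probability R R :=
  distribution (normal_prob 0 1) to_R.

End std_normal.

Section gaussian.
Context (R : realType).
Implicit Types m z : R.
Local Notation gamma := (std_normal R).

(* density of N(m, 1) with respect to N(0, 1) *)
Definition glik m z : R := expR (m * z - m ^+ 2 / 2).

Lemma glik_gt0 m z : 0 < glik m z. Proof. exact: expR_gt0. Qed.

Lemma measurable_glik m : measurable_fun setT (glik m).
Proof.
by apply: measurableT_comp => //; exact: measurable_funB.
Qed.

Lemma ln_glik m z : ln (glik m z) = m * z - m ^+ 2 / 2.
Proof. exact: expRK. Qed.

Lemma normal_pdf_shift m z : normal_pdf 0 1 (z - m) = normal_pdf 0 1 z * glik m z.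
Proof.
rewrite !normal_pdfE ?oner_eq0// -mulrA; congr *%R.
rewrite /normal_fun /glik -expRD; congr expR; rewrite expr1n subr0 subr0; by field.
Qed.

Lemma integral_normal (f : R -> \bar R) : measurable_fun setT f ->
  (forall z, (0 <= f z)%E) ->
  (\int[gamma]_z f z = \int[lebesgue_measure]_z (f z * (normal_pdf 0 1 z)%:E))%E.
Proof.
move=> mf f0; rewrite ge0_integral_distribution//.
apply: (@integral_density _ _ _ (normal_prob 0 1) lebesgue_measure (normal_pdf 0 1))
  => //; exact: measurable_normal_pdf.
Qed.

(** The Cameron-Martin formula in dimension one: a shift of the variable becomes the weight
    [glik m]. *)
Lemma integral_normal_translate m (f : R -> \bar R) : measurable_fun setT f ->
  (forall z, (0 <= f z)%E) ->
  (\int[gamma]_z f (z + m)%R = \int[gamma]_z (f z * (glik m z)%:E))%E.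
Proof.
move=> mf f0; have mD : measurable_fun setT (+%R^~ m : R -> R).
  exact: measurable_funD.
have mN : measurable_fun setT (normal_pdf (0 : R) 1) by exact: measurable_normal_pdf.
rewrite !integral_normal//; last 3 first.
- apply: emeasurable_funM => //.
  by apply/measurable_EFinP; exact: measurable_glik.
- by move=> z; rewrite mule_ge0// lee_fin ltW// glik_gt0.
- exact: measurableT_comp mf mD.
under [RHS]eq_integral => z _.
  rewrite -muleA -EFinM mulrC -normal_pdf_shift; over.
have mg : measurable_fun setT (fun z => f z * (normal_pdf 0 1 (z - m)%R)%:E)%E.
  apply: emeasurable_funM => //; apply/measurable_EFinP.
  by apply: measurableT_comp => //; exact: measurable_funB.
have g0 z : (0 <= f z * (normal_pdf 0 1 (z - m)%R)%:E)%E.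
  by rewrite mule_ge0// lee_fin normal_pdf_ge0.
transitivity (\int[pushforward lebesgue_measure
  (+%R^~ m : R -> measurableTypeR R)]_z (f z * (normal_pdf 0 1 (z - m)%R)%:E))%E.
  rewrite ge0_integral_pushforward; [|exact: mD|exact: measurableT|exact: mg|].
    by rewrite preimage_setT; apply: eq_integral => z _; rewrite /comp addrK.
  by move=> z _; exact: g0.
apply: eq_measure_integral => A mA _.
exact: lebesgue_measure_translate.
Qed.

Lemma integral_glik m : (\int[gamma]_z (glik m z)%:E = 1)%E.
Proof.
have := @integral_normal_translate m (cst 1%E) (measurable_cst _) (fun=> lee01).
rewrite integral_cst// mul1e [X in X = _](_ : _ = 1%E) => [E|].
  by rewrite [RHS]E; apply: eq_integral => z _; rewrite mul1e.
exact: (@probability_setT _ _ _ gamma).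
Qed.

Lemma integrable_glik m : gamma.-integrable setT (EFin \o glik m).
Proof.
apply/integrableP; split; first by apply/measurable_EFinP; exact: measurable_glik.
under eq_integral do rewrite /= ger0_norm ?(ltW (glik_gt0 _ _))//.
by rewrite integral_glik ltry.
Qed.

Lemma glik_exp m t z : expR (t * z) * glik m z
  = expR (t * m + t ^+ 2 / 2) * glik (m + t) z.
Proof. by rewrite /glik -!expRD; congr expR; field. Qed.

Lemma integrable_mul_glik m : gamma.-integrable setT (fun z => (z * glik m z)%:E).
Proof.
(* The majorant comes from [|z| <= expR z + expR (- z)]: multiplying [glik m] by either exponential
   gives a constant times a [glik] of shifted mean. *)
pose g z := expR (1 * m + 1 ^+ 2 / 2) * glik (m + 1) z +
  expR (- 1 * m + (- 1) ^+ 2 / 2) * glik (m - 1) z.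
have ig : gamma.-integrable setT (EFin \o g).
  rewrite (_ : EFin \o g = (fun z => (expR (1 * m + 1 ^+ 2 / 2))%:E
    * (EFin \o glik (m + 1)) z + (expR (- 1 * m + (- 1) ^+ 2 / 2))%:E
    * (EFin \o glik (m - 1)) z)%E).
    by apply: integrableD => //; apply: integrableZl => //; exact: integrable_glik.
  by apply/funext => z /=; rewrite EFinD !EFinM.
apply: le_integrable ig => //.
  apply/measurable_EFinP; apply: measurable_funM => //; exact: measurable_glik.
move=> z _ /=; rewrite lee_fin /g -!glik_exp -mulrDl !normrM ler_wpM2r//.
rewrite [leRHS]ger0_norm ?addr_ge0 ?expR_ge0// mul1r mulN1r.
have := expR_ge1Dx z; have := expR_ge1Dx (- z); have := expR_gt0 z.
have := expR_gt0 (- z); rewrite ler_norml; lra.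
Qed.

(** The mean is found without differentiating under the integral: integrating
    [1 + t * z <= expR (t * z)] gives [key] for every [t]. Both sides of [key] equal 1 at [t = 0],
    so their slopes [mu] and [m] there must coincide. *)
Lemma integral_mul_glik m : (\int[gamma]_z (z * glik m z)%:E = m%:E)%E.
Proof.
have fi : (\int[gamma]_z (z * glik m z)%:E)%E \is a fin_num.
  exact: integrable_fin_num (integrable_mul_glik m).
rewrite -(fineK fi); congr EFin; set mu := fine _.
have key t : 1 + t * mu <= expR (t * m + t ^+ 2 / 2).
  rewrite -lee_fin.
  have -> : (1 + t * mu)%:E = (\int[gamma]_z (glik m z + t * (z * glik m z))%:E)%E.
    under eq_integral do rewrite EFinD EFinM.
    rewrite integralD//; [|exact: integrable_glik|].
      rewrite integralZl//; last exact: integrable_mul_glik.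
      by rewrite integral_glik -(fineK fi).
    by apply: integrableZl => //; exact: integrable_mul_glik.
  have -> : (expR (t * m + t ^+ 2 / 2))%:E =
      (\int[gamma]_z (expR (t * m + t ^+ 2 / 2) * glik (m + t) z)%:E)%E.
    under eq_integral do rewrite EFinM.
    by rewrite integralZl ?integral_glik ?mule1//; exact: integrable_glik.
  apply: le_integral => //.
  - rewrite (_ : (fun z => _) = (fun z => (EFin \o glik m) z
      + t%:E * (z * glik m z)%:E)%E); last by apply/funext => z; rewrite EFinD EFinM.
    apply: integrableD => //; first exact: integrable_glik.
    by apply: integrableZl => //; exact: integrable_mul_glik.
  - rewrite (_ : (fun z => _) = (fun z => (expR (t * m + t ^+ 2 / 2))%:E
      * (EFin \o glik (m + t)) z)%E); last by apply/funext => z; rewrite EFinM.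
    by apply: integrableZl => //; exact: integrable_glik.
  - move=> z _; rewrite lee_fin -glik_exp mulrA -[X in X + _]mul1r -mulrDl.
    by rewrite ler_wpM2r ?expR_ge1Dx// ltW// glik_gt0.
(* If [k = mu - m] were nonzero, [key] would fail at [t = s * k] for small [s]. The choice
   [s * D = 1 / 2] gives both [|y| <= 1 / 2], so that [expR y] can be replaced by [1 / (1 - y)], and
   positivity of the final factor [1 - s / 2 - s * (mu * b)]. *)
apply/eqP; rewrite -subr_eq0; apply/negPn/negP => k0; set k := mu - m in k0.
set D := 1 + `|mu| * (`|m| + `|k|) + `|k| * (`|m| + `|k|).
have D1 : 1 <= D.
  by rewrite /D -addrA lerDl addr_ge0// mulr_ge0// addr_ge0.
have [s [s0 sD]] : exists s, 0 < s /\ s * D = 2^-1.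
  exists (D^-1 / 2); split; first by rewrite divr_gt0// invr_gt0 (lt_le_trans _ D1).
  by field; rewrite gt_eqF// (lt_le_trans _ D1).
have s1 : s <= 2^-1 by rewrite -sD ler_peMr// ltW.
pose b := m + s * k / 2; pose y := s * k * b.
have bB : `|b| <= `|m| + `|k|.
  rewrite /b (le_trans (ler_normD _ _))// lerD2l !normrM (gtr0_norm s0).
  have := normr_ge0 k; have -> : `|2^-1 : R| = 2^-1 by rewrite gtr0_norm.
  nra.
have ay : `|y| <= 2^-1.
  rewrite /y !normrM (gtr0_norm s0) -sD -mulrA ler_wpM2l ?ltW// /D.
  have : `|k| * `|b| <= `|k| * (`|m| + `|k|) by rewrite ler_wpM2l.
  have : 0 <= `|mu| * (`|m| + `|k|) by rewrite mulr_ge0// addr_ge0.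
  lra.
have := key (s * k).
have -> : s * k * m + (s * k) ^+ 2 / 2 = y by rewrite /y /b; field.
have ey : expR y * (1 - y) <= 1.
  have : (1 - y) <= expR (- y) by exact: expR_ge1Dx.
  by rewrite -(ler_pM2l (expR_gt0 y)) -expRD subrr expR0.
have y1 : 0 < 1 - y by move: ay; rewrite ler_norml; lra.
move=> h; have : (1 + s * k * mu) * (1 - y) <= 1.
  by apply: le_trans ey; rewrite ler_wpM2r// ltW.
have -> : (1 + s * k * mu) * (1 - y) = 1 + s * (k ^+ 2) * (1 - s / 2 - s * (mu * b)).
  by rewrite /y /b /k; field.
rewrite gerDl leNgt => /negP; apply.
have k2 : 0 < k ^+ 2 by rewrite exprn_even_gt0.
apply: mulr_gt0; first exact: mulr_gt0.
have mb : mu * b <= `|mu| * (`|m| + `|k|).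
  by rewrite (le_trans (ler_norm _))// normrM ler_wpM2l.
have : s * (mu * b) <= s * D - s.
  have -> : s * D - s = s * (D - 1) by ring.
  rewrite ler_wpM2l ?(ltW s0)// /D (le_trans mb)//.
  have : 0 <= `|k| * (`|m| + `|k|) by rewrite mulr_ge0// addr_ge0.
  lra.
rewrite sD; lra.
Qed.

(** Both the lower and the upper bound on the entropy after a Gaussian observation have this shape,
    so their integrals are closed formulas in the means. *)
Lemma integral_affine_glik (I : finType) (a b m : I -> R) :
  let f z := \sum_i (a i + b i * z) * glik (m i) z in
  gamma.-integrable setT (EFin \o f) /\
  (\int[gamma]_z (f z)%:E = (\sum_i (a i + b i * m i))%:E)%E.
Proof.
pose g i z := ((a i)%:E * (EFin \o glik (m i)) z
  + (b i)%:E * (z * glik (m i) z)%:E)%E.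
have ig1 i := integrableZl measurableT (a i) (integrable_glik (m i)).
have ig2 i := integrableZl measurableT (b i) (integrable_mul_glik (m i)).
have ig i : gamma.-integrable setT (g i) by exact: integrableD.
move=> f; have fE : EFin \o f = fun z => (\sum_i g i z)%E.
  apply/funext => z /=; rewrite -sumEFin; apply: eq_bigr => i _.
  by rewrite /g /= -!EFinM -EFinD mulrDl mulrA.
split; first by rewrite fE; exact: integrable_sum.
transitivity (\int[gamma]_z (\sum_i g i z))%E.
  by apply: eq_integral => z _; rewrite -(congr1 (@^~ z) fE).
rewrite integral_sum// -sumEFin; apply: eq_bigr => i _.
rewrite integralD// (integralZl measurableT (integrable_glik (m i))).
rewrite (integralZl measurableT (integrable_mul_glik (m i))).
by rewrite integral_glik integral_mul_glik mule1 EFinD EFinM.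
Qed.

End gaussian.

Section gaussian_channel.
Context (R : realType) (F : finType).
Implicit Types w m : F -> R.
Local Notation gamma := (std_normal R).

Lemma measurable_ent d (T : measurableType d) (u : T -> F -> R) :
  (forall x, measurable_fun setT (u ^~ x)) ->
  measurable_fun setT (fun t => ent (u t)).
Proof.
move=> mu; apply: measurable_funB.
  apply: measurable_funM; first exact: measurable_sum.
  by apply: measurableT_comp => //; exact: measurable_sum.
apply: measurable_sum => x; apply: measurable_funM => //.
exact: measurableT_comp.
Qed.

Lemma expR_le_quadratic (t : R) : `|t| <= 2^-1 -> expR t <= 1 + t + 2 * t ^+ 2.
Proof.
move=> t2; have t1 : 0 < 1 - t by move: t2; rewrite ler_norml; lra.
have e1 : expR t * (1 - t) <= 1.
  have : 1 - t <= expR (- t) by exact: expR_ge1Dx.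
  by rewrite -(ler_pM2l (expR_gt0 t)) -expRD subrr expR0.
rewrite -(ler_pM2r t1) (le_trans e1)//.
have -> : (1 + t + 2 * t ^+ 2) * (1 - t) = 1 + t ^+ 2 * (1 - 2 * t) by ring.
by rewrite lerDl mulr_ge0 ?sqr_ge0//; move: t2; rewrite ler_norml; lra.
Qed.

(** The entropy after observing [z] is an explicit part, affine in [z] against tilts, plus a
    relative entropy integrand between the mixture [M] and its reference. The explicit part alone
    integrates to [ent w - variance w m / 2]; nonnegativity of relative entropy gives the lower
    bound, and the chi-square divergence is the error in the upper one. *)
Lemma ent_gauss_approx w m (B : R) : (forall x, 0 < w x) -> 0 < \sum_x w x ->
  B <= 4^-1 -> (forall x, `|m x| <= B) ->
  ((ent w - variance w m / 2)%:E
    <= \int[gamma]_z (ent (fun x => w x * glik (m x) z))%:E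
    <= (ent w - variance w m / 2 + (\sum_x w x) * (32 * B ^+ 4))%:E)%E.
Proof.
move=> w0 W0 B4 mB; set W := \sum_x w x; set a := mean w m.
have aB : `|a| <= B by apply: mean_norm.
pose M z := \sum_x w x * glik (m x) z.
(* [A x + (a - m x) * z] is the log-ratio of [W * glik a z] to [w x * glik (m x) z]. *)
pose A x := ln W - a ^+ 2 / 2 - ln (w x) + m x ^+ 2 / 2.
have wg0 x z : 0 < w x * glik (m x) z by rewrite mulr_gt0 ?glik_gt0.
have M0 z : 0 < M z.
  have [x _ wx] : exists2 x, x \in F & 0 < w x.
    case: (pickP (fun _ : F => true)) => [x _|F0]; first by exists x.
    by move: W0; rewrite big_pred0 ?ltxx.
  rewrite /M (bigD1 x)//= ltr_pwDl// sumr_ge0// => y _; exact: ltW.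
have Wr0 z : 0 < W * glik a z by rewrite mulr_gt0 ?glik_gt0.
(* Both bounds compare the entropy of the mixture with the centred tilt [W * glik a]. *)
have entz z : ent (fun x => w x * glik (m x) z) =
    M z * ln (M z) - M z * ln (W * glik a z)
    + \sum_x (w x * A x + w x * (a - m x) * z) * glik (m x) z.
  rewrite /ent -/(M z) -addrA; congr (_ + _).
  rewrite [X in _ = - X + _](mulr_suml _ _ (fun x => w x * glik (m x) z)).
  rewrite [RHS]addrC -sumrB -sumrN; apply: eq_bigr => x _.
  rewrite !lnM ?posrE ?glik_gt0// !ln_glik /A; ring.
pose L z := \sum_(i : F + F) (match i with
    inl x => w x * (A x + 1) | inr x => - w x end
  + match i with inl x => w x * (a - m x) | inr _ => 0 end * z)
  * glik (match i with inl x => m x | inr _ => a end) z.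
pose c x := m x - a.
(* The pairs expand [M z ^+ 2 / (W * glik a z)]: completing the square turns
   [glik (m x) * glik (m y) / glik a] into [expR (c x * c y)] times the tilt of mean
   [m x + m y - a]. The means being explicit, each term has a known integral. *)
pose U z := \sum_(i : F + F * F) (match i with
    inl x => w x * (A x - 1)
  | inr xy => w xy.1 * w xy.2 / W * expR (c xy.1 * c xy.2) end
  + match i with inl x => w x * (a - m x) | inr _ => 0 end * z)
  * glik (match i with inl x => m x | inr xy => m xy.1 + m xy.2 - a end) z.
have LE z : L z = M z - W * glik a z
    + \sum_x (w x * A x + w x * (a - m x) * z) * glik (m x) z.
  rewrite /L big_sumType /= [RHS]addrAC; congr (_ + _).
    by rewrite /M -big_split/=; apply: eq_bigr => x _; ring.
  by rewrite /W mulr_suml -sumrN; apply: eq_bigr => x _; ring.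
have UE z : U z = M z * (M z / (W * glik a z) - 1)
    + \sum_x (w x * A x + w x * (a - m x) * z) * glik (m x) z.
  rewrite /U big_sumType /= [in RHS]mulrBr mulr1 mulrA -[RHS]addrA [RHS]addrC.
  congr (_ + _).
    by rewrite -sumrN -big_split/=; apply: eq_bigr => x _; ring.
  rewrite /M big_distrlr/= pair_big/= mulr_suml.
  apply: eq_bigr => -[x y] _ /=; rewrite mul0r addr0 invfM.
  rewrite [glik (m x + m y - a) z](_ : _ =
    glik (m x) z * glik (m y) z / glik a z / expR (c x * c y)).
    by field; rewrite !gt_eqF ?expR_gt0.
  rewrite /glik -!expRN -!expRD; congr expR; rewrite /c; by field.
have Lent z : L z <= ent (fun x => w x * glik (m x) z).
  rewrite entz LE lerD2r; have := xlnx_ge (M0 z) (Wr0 z); lra.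
have entU z : ent (fun x => w x * glik (m x) z) <= U z.
  rewrite entz UE lerD2r; have := xlnx_le (M0 z) (Wr0 z); lra.
have [iL IL] : gamma.-integrable setT (EFin \o L) /\ _ :=
  integral_affine_glik _ _ _.
have [iU IU] : gamma.-integrable setT (EFin \o U) /\ _ :=
  integral_affine_glik _ _ _.
have ient : gamma.-integrable setT
    (fun z => (ent (fun x => w x * glik (m x) z))%:E).
  apply: le_integrable iU => //.
    apply/measurable_EFinP/measurable_ent => x.
    by apply: measurable_funM => //; exact: measurable_glik.
  move=> z _ /=; have e0 : 0 <= ent (fun x => w x * glik (m x) z) by exact: ent_ge0.
  by rewrite lee_fin !ger0_norm// (le_trans e0).
have Wa : \sum_x w x * m x = W * a by rewrite /a /mean mulrC divfK// gt_eqF.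
have sA : \sum_x (w x * A x + w x * (a - m x) * m x) = ent w - variance w m / 2.
  rewrite (eq_bigr (fun x => (ln W - a ^+ 2 / 2) * w x - w x * ln (w x)
    - 2^-1 * (w x * m x ^+ 2) + a * (w x * m x))); last first.
    by move=> x _; rewrite /A; field.
  rewrite big_split/= !sumrB -!mulr_sumr Wa /ent /variance -/W -/a; by field.
apply/andP; split.
- have <- : (\int[gamma]_z (L z)%:E)%E = (ent w - variance w m / 2)%:E.
    rewrite IL; congr EFin; rewrite big_sumType /= -sA.
    rewrite -big_split/=; apply: eq_bigr => x _; ring.
  by apply: le_integral => // z _; rewrite lee_fin.
- apply: (@le_trans _ _ (\int[gamma]_z (U z)%:E)%E).
    by apply: le_integral => // z _; rewrite lee_fin.
  rewrite IU lee_fin big_sumType /= -sA.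
  rewrite (eq_bigr (fun x => (w x * A x + w x * (a - m x) * m x) - w x)); last first.
    by move=> x _; ring.
  rewrite sumrB -addrA lerD2l addrC lerBlDr -/W.
  have cB x : `|c x| <= 2 * B.
    by rewrite (le_trans (ler_normB _ _))//; have := mB x; lra.
  have B0 : 0 <= B by apply: le_trans aB.
  have cc x y : `|c x * c y| <= 4 * B ^+ 2.
    rewrite normrM (_ : 4 * B ^+ 2 = (2 * B) * (2 * B)); last ring.
    by apply: ler_pM.
  (* Centring at the weighted mean removes the linear term of [expR (c x * c y)] from the double
     sum. What remains is [2 * (c x * c y) ^+ 2], at most [2 * (4 * B ^+ 2) ^+ 2], which is the
     [32 * B ^+ 4] of the statement. *)
  have c0 : \sum_x w x * c x = 0.
    rewrite (eq_bigr (fun x => w x * m x - a * w x)); last by move=> x _; rewrite /c; ring.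
    by rewrite sumrB Wa -mulr_sumr -/W; ring.
  apply: (@le_trans _ _ (\sum_(xy : F * F) w xy.1 * w xy.2 / W *
      (1 + c xy.1 * c xy.2 + 32 * B ^+ 4))).
    apply: ler_sum => -[x y] _ /=; rewrite mul0r addr0.
    have ww : 0 <= w x * w y / W by rewrite ltW// divr_gt0// mulr_gt0.
    rewrite ler_wpM2l//.
    have B16 : 4 * B ^+ 2 <= 2^-1 by nra.
    apply: (le_trans (expR_le_quadratic (le_trans (cc x y) B16))).
    rewrite lerD2l -[(c x * c y) ^+ 2]real_normK ?num_real//.
    rewrite (_ : 32 * B ^+ 4 = 2 * (4 * B ^+ 2) ^+ 2); last ring.
    by rewrite ler_wpM2l// lerXn2r ?nnegrE// mulr_ge0// sqr_ge0.
  rewrite (eq_bigr (fun xy => (1 + 32 * B ^+ 4) / W * (w xy.1 * w xy.2)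
     + W^-1 * ((w xy.1 * c xy.1) * (w xy.2 * c xy.2)))); last first.
    by move=> -[x y] _ /=; ring.
  rewrite big_split/= -!mulr_sumr.
  rewrite -(pair_big xpredT xpredT (fun x y => w x * w y))/=.
  rewrite -(pair_big xpredT xpredT (fun x y => (w x * c x) * (w y * c y)))/=.
  rewrite -!big_distrlr/= c0 -/W !mul0r mulr0 addr0.
  by rewrite le_eqVlt; apply/orP; left; apply/eqP; field; rewrite gt_eqF.
Qed.

End gaussian_channel.

(** * Product measures on tuples *)

Section tuple_cons.
Context d (T : measurableType d) (N : nat).

Definition tcons (yt : T * N.-tuple T) : N.+1.-tuple T := [tuple of yt.1 :: yt.2].

Lemma measurable_tcons : measurable_fun setT tcons.
Proof. exact: measurable_cons. Qed.

HB.instance Definition _ :=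
  isMeasurableFun.Build _ _ _ _ tcons measurable_tcons.

Lemma tnth_tconsS yt (k : 'I_N) : tnth (tcons yt) (lift ord0 k) = tnth yt.2 k.
Proof. exact: tnthS. Qed.

End tuple_cons.

Section product_tuple.
Context d (T : measurableType d) (R : realType) (mu : probability T R).

(** The recursion on coordinates lets Tonelli peel off the first one, in step with the recursion of
    [splits] below. *)
Fixpoint iidm (N : nat) : probability (N.-tuple T) R :=
  if N is N'.+1 then distribution (mu \x iidm N')%E (@tcons _ T N')
  else \d_([tuple] : 0.-tuple T).

Definition rect N (B : 'I_N -> set T) : set (N.-tuple T) :=
  \bigcap_k ((@tnth N T)^~ k @^-1` B k).

Lemma measurable_rect N (B : 'I_N -> set T) :
  (forall k, measurable (B k)) -> measurable (rect B).
Proof.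
move=> mB; apply: fin_bigcap_measurable => //.
by move=> k _; rewrite -[X in measurable X]setTI; exact: measurable_tnth.
Qed.

(** Rectangles are stable under intersection and generate the product sigma-algebra: a cylinder over
    one coordinate is a rectangle whose other sides are full. *)
Lemma measure_tuple_unique N (m1 m2 : probability (N.-tuple T) R) :
  (forall B : 'I_N -> set T, (forall k, measurable (B k)) ->
    m1 (rect B) = m2 (rect B)) ->
  forall A, measurable A -> m1 A = m2 A.
Proof.
move=> m12 A mA.
pose G : set (set (N.-tuple T)) :=
  [set A | exists2 B : 'I_N -> set T, (forall k, measurable (B k)) & A = rect B].
have rectT : rect (fun _ : 'I_N => setT) = setT.
  by apply/seteqP; split.
apply: (g_sigma_algebra_measure_unique G _ (fun=> setT)).
- by move=> _ [B mB ->]; exact: measurable_rect.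
- by move=> _; exists (fun=> setT).
- by apply/seteqP; split => // t _; exists 0%N.
- move=> _ _ [B mB ->] [C mC ->]; exists (fun k => B k `&` C k).
    by move=> k; exact: measurableI.
  apply/seteqP; split; last first.
    by move=> t BC; split=> k _; have [] := BC k I.
  by move=> t [Bt Ct] k _; split; [exact: Bt|exact: Ct].
- by move=> _ [B mB ->]; exact: m12.
- by move=> k; rewrite ltey_eq fin_num_measure.
- apply: smallest_sub mA; first exact: smallest_sigma_algebra.
  rewrite -bigcup_seq => X [k _ [C mC <-]]; apply: sub_sigma_algebra.
  exists (fun j => if j == k then C else setT).
    by move=> j; case: ifP.
  rewrite setTI; apply/seteqP; split => t.
    by move=> Ct j _ /=; case: eqVneq => // ->.
  by move=> /(_ k I) /=; rewrite eqxx.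
Qed.

Lemma iidm_rect N (B : 'I_N -> set T) : (forall k, measurable (B k)) ->
  iidm N (rect B) = (\prod_k mu (B k))%E.
Proof.
elim: N B => [|N IH] B mB.
  rewrite big_ord0 /= diracE mem_set// => k; by case: k.
have E : @tcons _ T N @^-1` rect B = B ord0 `*` rect (fun k => B (lift ord0 k)).
  apply/seteqP; split => [[y t]/= Bt|[y t]/= [By Bt] k _ /=].
    split; first exact: (Bt ord0 I).
    by move=> k _; have := Bt (lift ord0 k) I; rewrite /= tnth_tconsS.
  have [j ->|->] := unliftP ord0 k; last by [].
  by rewrite tnth_tconsS; exact: (Bt j I).
rewrite big_ord_recl -IH// -product_measure1E//; last exact: measurable_rect.
by rewrite -E.
Qed.

Lemma iidm_unique N (m : probability (N.-tuple T) R) :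
  (forall B : 'I_N -> set T, (forall k, measurable (B k)) ->
    m (rect B) = (\prod_k mu (B k))%E) ->
  forall A, measurable A -> m A = iidm N A.
Proof.
move=> mE; apply: measure_tuple_unique => B mB.
by rewrite mE// iidm_rect.
Qed.

Lemma integral_iidmS N (f : N.+1.-tuple T -> \bar R) :
  measurable_fun setT f -> (forall t, (0 <= f t)%E) ->
  (\int[iidm N.+1]_t f t = \int[iidm N]_t \int[mu]_y f (tcons (y, t)))%E.
Proof.
move=> mf f0; rewrite ge0_integral_distribution//.
rewrite fubini_tonelli2//; last by move=> t /=.
exact: measurableT_comp.
Qed.

Lemma measurable_iidmS N (f : N.+1.-tuple T -> \bar R) :
  measurable_fun setT f -> (forall t, (0 <= f t)%E) ->
  measurable_fun setT (fun t => \int[mu]_y f (tcons (y, t)))%E.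
Proof.
move=> mf f0.
apply: (@measurable_fun_fubini_tonelli_G _ _ _ _ _ mu (f \o @tcons _ T N)) => //.
  exact: measurableT_comp.
by move=> t /=.
Qed.

End product_tuple.

Section gaussian_tuple.
Context (R : realType).
Local Notation gamma := (std_normal R).

Definition gliks N (m : 'I_N -> R) (t : N.-tuple R) : R :=
  \prod_k glik (m k) (tnth t k).

Lemma gliks_gt0 N (m : 'I_N -> R) t : 0 < gliks m t.
Proof. by apply: prodr_gt0 => k _; exact: glik_gt0. Qed.

Lemma measurable_gliks N (m : 'I_N -> R) : measurable_fun setT (gliks m).
Proof.
apply: measurable_prod => k _.
by apply: measurableT_comp; [exact: measurable_glik|exact: measurable_tnth].
Qed.

Lemma gliks_tcons N (m : 'I_N.+1 -> R) y t :
  gliks m (tcons (y, t)) = glik (m ord0) y * gliks (fun k => m (lift ord0 k)) t.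
Proof.
rewrite /gliks big_ord_recl; congr (_ * _).
by apply: eq_bigr => k _; rewrite tnth_tconsS.
Qed.

Definition shift_tuple N (m : 'I_N -> R) (t : N.-tuple R) : N.-tuple R :=
  [tuple tnth t k + m k | k < N].

Lemma measurable_shift_tuple N (m : 'I_N -> R) :
  measurable_fun setT (shift_tuple m).
Proof.
apply/measurable_fun_tnthP => k.
rewrite (_ : _ \o _ = fun t => tnth t k + m k).
  by apply: measurable_funD => //; exact: measurable_tnth.
by apply/funext => t /=; rewrite tnth_mktuple.
Qed.

Lemma shift_tcons N (m : 'I_N.+1 -> R) y t : shift_tuple m (tcons (y, t)) =
  tcons (y + m ord0, shift_tuple (fun k => m (lift ord0 k)) t).
Proof.
apply: eq_from_tnth => k; rewrite tnth_mktuple.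
by have [j ->|->] := unliftP ord0 k; rewrite ?tnth_tconsS ?tnth_mktuple.
Qed.

(** The Cameron-Martin formula in dimension [N], one coordinate at a time. *)
Lemma integral_iidm_translate N (m : 'I_N -> R) (f : N.-tuple R -> \bar R) :
  measurable_fun setT f -> (forall t, (0 <= f t)%E) ->
  (\int[iidm gamma N]_t f (shift_tuple m t)
   = \int[iidm gamma N]_t (f t * (gliks m t)%:E))%E.
Proof.
elim: N m f => [|N IH] m f mf f0.
  apply: eq_integral => t _; rewrite /gliks big_ord0 mule1; congr f.
  by apply: eq_from_tnth => -[].
have mfs : measurable_fun setT (fun t => f (shift_tuple m t)).
  exact: (measurableT_comp mf (measurable_shift_tuple m)).
have mg k : measurable_fun setT (EFin \o glik (m k)).
  by apply/measurable_EFinP; exact: measurable_glik.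
have mgs (m' : 'I_N.+1 -> R) : measurable_fun setT (EFin \o gliks m').
  by apply/measurable_EFinP; exact: measurable_gliks.
pose m' (k : 'I_N) := m (lift ord0 k).
pose h t := (\int[gamma]_y (f (tcons (y, t)) * (glik (m ord0) y)%:E))%E.
have fg0 t : (0 <= f t * (glik (m ord0) (tnth t ord0))%:E)%E.
  by rewrite mule_ge0// lee_fin ltW// glik_gt0.
have mfg : measurable_fun setT
    (fun t => f t * (glik (m ord0) (tnth t ord0))%:E)%E.
  apply: emeasurable_funM => //.
  by apply: measurableT_comp (mg ord0) _; exact: measurable_tnth.
have mh : measurable_fun setT h := measurable_iidmS gamma mfg fg0.
have h0 t : (0 <= h t)%E by apply: integral_ge0 => y _; exact: fg0 (tcons (y, t)).
have mc t : measurable_fun setT (fun y : R => f (tcons (y, t))).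
  apply: (measurableT_comp mf).
  by apply: (@measurable_cons _ _ _ _ id N (cst t)) => //; exact: measurable_id.
have fG0 t : (0 <= f t * (gliks m t)%:E)%E.
  by rewrite mule_ge0// lee_fin ltW// gliks_gt0.
have mfG : measurable_fun setT (fun t => f t * (gliks m t)%:E)%E.
  exact: (emeasurable_funM mf (mgs m)).
rewrite integral_iidmS// [RHS]integral_iidmS//.
transitivity (\int[iidm gamma N]_t h (shift_tuple m' t))%E.
  apply: eq_integral => t _ /=.
  apply: etrans (integral_normal_translate (m ord0) (mc (shift_tuple m' t))
    (fun y => f0 _)).
  by apply: eq_integral => y _; rewrite shift_tcons.
rewrite IH//; apply: eq_integral => t _.
rewrite -ge0_integralZr//.
- by apply: eq_integral => y _; rewrite gliks_tcons EFinM muleA.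
- exact: (emeasurable_funM (mc t) (mg ord0)).
- by rewrite lee_fin ltW// gliks_gt0.
Qed.

Lemma integral_gliks N (m : 'I_N -> R) :
  (\int[iidm gamma N]_t (gliks m t)%:E = 1)%E.
Proof.
have := integral_iidm_translate m (f := cst 1%E) (measurable_cst _) (fun=> lee01).
rewrite integral_cst// mul1e [X in X = _](_ : _ = 1%E) => [E|].
  by rewrite [RHS]E; apply: eq_integral => t _; rewrite mul1e.
exact: (@probability_setT _ _ _ (iidm gamma N)).
Qed.

End gaussian_tuple.

(** * Exchanging the channels *)

Section interpolation.
Context (R : realType) (F : finType) (delta : R).
Hypothesis delta0 : 0 <= delta.
Implicit Types (w m q : F -> R) (Psi : (F -> R) -> R).
Local Notation gamma := (std_normal R).

(** The value of [Psi] summed over the two outcomes of a Bernoulli observation whose success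
    probability given [x] is [q x]. *)
Definition split Psi q w : R :=
  Psi (fun x => w x * q x) + Psi (fun x => w x * (1 - q x)).

(** The bound is uniform in the weights because, at the moment of the exchange, they already carry
    the likelihood of other observations. *)
Definition close_channels Psi q m := forall w, (forall x, 0 < w x) ->
  ((split Psi q w - delta * \sum_x w x)%:E
    <= \int[gamma]_z (Psi (fun x => w x * glik (m x) z))%:E
    <= (split Psi q w + delta * \sum_x w x)%:E)%E.

(* A functional of the posterior weights for which exchanging one Bernoulli
   observation for one Gaussian observation costs at most [delta] times the
   total mass; the pairs of channels considered are those exchangeable for [ent]. *)
Definition admissible Psi :=
  [/\ forall w, (forall x, 0 < w x) -> 0 <= Psi w,
      forall d (T : measurableType d) (u : T -> F -> R),
        (forall x, measurable_fun setT (u ^~ x)) ->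
        measurable_fun setT (fun t => Psi (u t)) &
      forall q m, (forall x, 0 < q x < 1) -> close_channels (@ent R F) q m ->
        close_channels Psi q m].

Lemma admissible_ent : admissible (@ent R F).
Proof.
split => //; first by move=> w w0; exact: ent_ge0.
by move=> d T u mu; exact: measurable_ent.
Qed.

(** The Bernoulli observation commutes with the exchanged one, so the exchange may be done in each
    of its two branches. The branch masses sum to the mass of [w], which keeps the same [delta]. *)
Lemma admissible_split Psi q : (forall x, 0 < q x < 1) ->
  admissible Psi -> admissible (split Psi q).
Proof.
move=> q01 [Psi0 mPsi cPsi].
have wq0 w x : (forall x, 0 < w x) -> 0 < w x * q x.
  by move=> w0; rewrite mulr_gt0//; have /andP[] := q01 x.
have wq1 w x : (forall x, 0 < w x) -> 0 < w x * (1 - q x).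
  by move=> w0; rewrite mulr_gt0// subr_gt0; have /andP[] := q01 x.
split.
- by move=> w w0; rewrite addr_ge0 ?Psi0// => x; [exact: wq0|exact: wq1].
- move=> d T u mu; apply: measurable_funD; apply: mPsi => x; exact: measurable_funM.
- move=> q2 m q201 cm w w0; have C := cPsi _ _ q201 cm.
  have C0 := C _ (wq0 w ^~ w0); have C1 := C _ (wq1 w ^~ w0).
  have sE : split (split Psi q) q2 w = split Psi q2 (fun x => w x * q x)
      + split Psi q2 (fun x => w x * (1 - q x)).
    rewrite /split addrACA; congr (Psi _ + Psi _ + (Psi _ + Psi _));
      by apply/funext => x; rewrite mulrAC.
  have wE : \sum_x w x = \sum_x w x * q x + \sum_x w x * (1 - q x).
    by rewrite -big_split/=; apply: eq_bigr => x _; ring.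
  have mP (p : F -> R) : measurable_fun setT
      (fun z => (Psi (fun x => w x * p x * glik (m x) z))%:E).
    apply/measurable_EFinP/mPsi => x; apply: measurable_funM => //.
    exact: measurable_glik.
  have iE : (\int[gamma]_z (split Psi q (fun x => w x * glik (m x) z))%:E =
      \int[gamma]_z (Psi (fun x => w x * q x * glik (m x) z))%:E +
      \int[gamma]_z (Psi (fun x => w x * (1 - q x) * glik (m x) z))%:E)%E.
    have mP0 := mP q; have mP1 := mP (fun x => 1 - q x).
    have P0 z : setT z -> (0 <= (Psi (fun x => w x * q x * glik (m x) z))%:E)%E.
      by move=> _; rewrite lee_fin Psi0// => x; rewrite mulr_gt0 ?glik_gt0 ?wq0.
    have P1 z : setT z ->
        (0 <= (Psi (fun x => w x * (1 - q x) * glik (m x) z))%:E)%E.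
      by move=> _; rewrite lee_fin Psi0// => x; rewrite mulr_gt0 ?glik_gt0 ?wq1.
    rewrite -ge0_integralD//.
    apply: eq_integral => z _; rewrite /split EFinD; congr (_ + _)%E.
      by congr (Psi _)%:E; apply/funext => x; rewrite mulrAC.
    by congr (Psi _)%:E; apply/funext => x; rewrite mulrAC.
  have /andP[l0 u0] := C0; have /andP[l1 u1] := C1.
  rewrite sE iE wE mulrDr opprD addrACA [X in (_ <= _ <= X%:E)%E]addrACA.
  by rewrite !EFinD -!EFinD; apply/andP; split; rewrite EFinD leeD.
Qed.

(** Each observation is absorbed into the functional rather than into the weights, so an induction
    on [N] has to quantify over [Psi]. *)
Fixpoint splits N : ('I_N -> F -> R) -> ((F -> R) -> R) -> (F -> R) -> R :=
  if N is N'.+1 then fun Q Psi w =>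
    splits (fun k => Q (lift ord0 k)) (split Psi (Q ord0)) w
  else fun _ Psi w => Psi w.

(* Tonelli integrates the first Gaussian coordinate innermost; exchanging it only
   moves the finite sums over Bernoulli observations past a Gaussian integral. *)
Lemma interpolation N (q m : 'I_N -> F -> R) Psi w :
  admissible Psi -> (forall x, 0 < w x) ->
  (forall k x, 0 < q k x < 1) ->
  (forall k, close_channels (@ent R F) (q k) (m k)) ->
  ((splits q Psi w)%:E <= \int[iidm gamma N]_t
      (Psi (fun x => w x * gliks (m ^~ x) t))%:E
      + (N%:R * (delta * \sum_x w x))%:E)%E /\
  (\int[iidm gamma N]_t (Psi (fun x => w x * gliks (m ^~ x) t))%:E
    <= (splits q Psi w + N%:R * (delta * \sum_x w x))%:E)%E.
Proof.
elim: N q m Psi => [|N IH] q m Psi aPsi w0 q01 cqm.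
  rewrite (_ : (\int[_]_t _)%E = (Psi w)%:E) /=.
    by rewrite mul0r -EFinD addr0.
  rewrite (_ : (fun t => _) = cst (Psi w)%:E).
    rewrite integral_cst//.
    by rewrite [X in (_ * X)%E](@probability_setT _ _ _ (iidm gamma 0)) mule1.
  apply/funext => t /=; congr (Psi _)%:E; apply/funext => x.
  by rewrite /gliks big_ord0 mulr1.
have [Psi0 mPsi cPsi] := aPsi.
have aS := admissible_split (q01 ord0) aPsi.
have [S0 mS _] := aS.
pose m' (k : 'I_N) x := m (lift ord0 k) x.
pose q' (k : 'I_N) x := q (lift ord0 k) x.
have [IH1 IH2] := IH q' m' _ aS w0 (fun k => q01 _) (fun k => cqm _).
pose u t x := w x * gliks (m' ^~ x) t.
have u0 t x : 0 < u t x by rewrite mulr_gt0// gliks_gt0.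
have mu x : measurable_fun setT (u ^~ x).
  by apply: measurable_funM => //; exact: measurable_gliks.
pose A := (\int[iidm gamma N]_t (split Psi (q ord0) (u t))%:E)%E.
pose I1 t := (\int[gamma]_y (Psi (fun x => u t x * glik (m ord0 x) y))%:E)%E.
have Psi_meas : measurable_fun setT (fun t : N.+1.-tuple R =>
    (Psi (fun x => w x * gliks (m ^~ x) t))%:E).
  apply/measurable_EFinP/mPsi => x; apply: measurable_funM => //.
  exact: measurable_gliks.
have Psi_ge0 (t : N.+1.-tuple R) : (0 <= (Psi (fun x => w x * gliks (m ^~ x) t))%:E)%E.
  by rewrite lee_fin Psi0// => x; rewrite mulr_gt0// gliks_gt0.
have PE t y : Psi (fun x => w x * gliks (m ^~ x) (tcons (y, t))) =
    Psi (fun x => u t x * glik (m ord0 x) y).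
  by congr (Psi _); apply/funext => x; rewrite gliks_tcons /u mulrA mulrAC.
have iE : (\int[iidm gamma N.+1]_t (Psi (fun x => w x * gliks (m ^~ x) t))%:E =
    \int[iidm gamma N]_t I1 t)%E.
  rewrite integral_iidmS//; apply: eq_integral => t _.
  by apply: eq_integral => y _; rewrite PE.
have mI1 : measurable_fun setT I1.
  have := measurable_iidmS gamma Psi_meas Psi_ge0.
  by congr measurable_fun; apply/funext => t; apply: eq_integral => y _; rewrite PE.
have I10 t : (0 <= I1 t)%E.
  apply: integral_ge0 => y _; rewrite lee_fin Psi0// => x.
  by rewrite mulr_gt0// glik_gt0.
pose D t := delta * \sum_x u t x.
have D0 t : 0 <= D t.
  by rewrite mulr_ge0// sumr_ge0// => x _; rewrite ltW.
have mD : measurable_fun setT (EFin \o D).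
  apply/measurable_EFinP/measurable_funM => //; exact: measurable_sum.
have meu x : measurable_fun setT (fun t => (u t x)%:E).
  by apply/measurable_EFinP; exact: mu.
(* Each [gliks] has integral 1, so the tilted weights have on average the mass of [w]: the exchange
   error does not depend on how many Gaussian observations remain. *)
have iD : (\int[iidm gamma N]_t (D t)%:E = (delta * \sum_x w x)%:E)%E.
  under eq_integral do rewrite EFinM -sumEFin.
  rewrite ge0_integralZl//; last 2 first.
  - by apply: emeasurable_sum => x; exact: meu.
  - by move=> t _; rewrite sumEFin lee_fin sumr_ge0// => x _; rewrite ltW.
  have u0e x t : setT t -> (0 <= (u t x)%:E)%E by rewrite lee_fin ltW.
  rewrite ge0_integral_sum//.
  rewrite EFinM -sumEFin; congr (_ * _)%E; apply: eq_bigr => x _.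
  under eq_integral do rewrite EFinM.
  have mgs : measurable_fun setT (fun t => (gliks (m' ^~ x) t)%:E).
    by apply/measurable_EFinP; exact: measurable_gliks.
  have gs0 t : setT t -> (0 <= (gliks (m' ^~ x) t)%:E)%E.
    by rewrite lee_fin ltW// gliks_gt0.
  rewrite ge0_integralZl ?lee_fin ?(ltW (w0 x))//.
  by rewrite integral_gliks mule1.
have mSu : measurable_fun setT (fun t => (split Psi (q ord0) (u t))%:E).
  by apply/measurable_EFinP; exact: mS.
have Su0 t : (0 <= (split Psi (q ord0) (u t))%:E)%E by rewrite lee_fin S0.
have ub : (\int[iidm gamma N]_t I1 t <= A + (delta * \sum_x w x)%:E)%E.
  rewrite -iD -ge0_integralD//; last by move=> t _; rewrite lee_fin.
  apply: ge0_le_integral => //.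
  - exact: emeasurable_funD.
  - move=> t _; rewrite -EFinD.
    by have /andP[] := cPsi _ _ (q01 ord0) (cqm ord0) _ (u0 t).
have lb : (A <= \int[iidm gamma N]_t I1 t + (delta * \sum_x w x)%:E)%E.
  rewrite -iD -ge0_integralD//; last by move=> t _; rewrite lee_fin.
  apply: ge0_le_integral => //.
  - exact: emeasurable_funD.
  - move=> t _; rewrite -leeBlDr//.
    by have /andP[] := cPsi _ _ (q01 ord0) (cqm ord0) _ (u0 t).
have NE : N.+1%:R * (delta * \sum_x w x) =
    N%:R * (delta * \sum_x w x) + delta * \sum_x w x.
  by rewrite -natr1 mulrDl mul1r.
rewrite iE NE; split.
- rewrite EFinD addeA addeAC; apply: (le_trans IH1).
  by rewrite leeD2r.
- by rewrite addrA EFinD (le_trans ub)// leeD2r.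
Qed.

Lemma splitsE N (q : 'I_N -> F -> R) Psi w : splits q Psi w =
  \sum_(g : N.-tuple bool)
    Psi (fun x => w x * \prod_k (if tnth g k then q k x else 1 - q k x)).
Proof.
elim: N q Psi w => [|N IH] q Psi w.
  rewrite (big_pred1 [tuple]) => [|g]; last exact/esym/eqP/tuple0.
  by rewrite /=; congr Psi; apply/funext => x; rewrite big_ord0 mulr1.
rewrite /= IH.
pose c (p : bool * N.-tuple bool) : N.+1.-tuple bool := [tuple of p.1 :: p.2].
rewrite (reindex c); last first.
  exists (fun g => (thead g, [tuple of behead g])).
    move=> [b g] _ /=; congr pair; exact: val_inj.
  by move=> g _; rewrite /c /= -tuple_eta.
rewrite -(pair_big xpredT xpredT (fun b g => Psi (fun x => w x *
  \prod_k (if tnth (c (b, g)) k then q k x else 1 - q k x))))/=.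
rewrite big_bool /= -big_split/=; apply: eq_bigr => g _.
rewrite /split; congr (Psi _ + Psi _); apply/funext => x;
  rewrite big_ord_recl -mulrA; congr (_ * _); rewrite mulrC; congr (_ * _);
  by apply: eq_bigr => k _; rewrite /c tnthS.
Qed.

End interpolation.

(** * Mutual information with a finite input *)

Section slice.
Context d d' (Om : measurableType d) (T : measurableType d') (R : realType).
Variables (P : probability Om R) (D : set Om) (mD : measurable D)
  (Y : {mfun Om >-> T}).

Lemma slice_lty : (P D < +oo)%E.
Proof. by rewrite ltey_eq fin_num_measure. Qed.

(* the law of [Y] on the event [D], of total mass [P D] *)
Definition slice : set T -> \bar R := pushforward (mfrestr mD slice_lty) Y.

Let slice0 : slice set0 = 0%E. Proof. exact: measure0. Qed.

Let slice_ge0 A : (0 <= slice A)%E. Proof. exact: measure_ge0. Qed.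

Let slice_sigma_additive : semi_sigma_additive slice.
Proof. exact: measure_semi_sigma_additive. Qed.

HB.instance Definition _ := isMeasure.Build _ _ _ slice
  slice0 slice_ge0 slice_sigma_additive.

Let slice_fin : fin_num_fun slice.
Proof.
move=> A mA; rewrite /slice /pushforward.
apply: (@fin_num_measure _ _ _ (mfrestr mD slice_lty)).
by rewrite -[X in measurable X]setTI; exact: (measurable_funPT Y).
Qed.

HB.instance Definition _ := Measure_isFinite.Build _ _ _ slice slice_fin.

Lemma integral_slice (f : T -> \bar R) : measurable_fun setT f ->
  (forall y, (0 <= f y)%E) ->
  (\int[slice]_y f y = \int[P]_w (f (Y w) * (\1_D w)%:E))%E.
Proof.
move=> mf f0; rewrite ge0_integral_pushforward//=.
apply: (@integral_density _ _ _ (mfrestr mD slice_lty) P (\1_D)).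
- exact: measurable_indic.
- move=> A mA; rewrite integral_indic// setIC.
  by [].
- exact: measurableT_comp.
- by move=> w; exact: f0.
Qed.

End slice.

Section measurable_lne.
Context (R : realType).

Lemma measurable_lne_fin d (T : measurableType d) (g : T -> \bar R) :
  (forall x, g x \is a fin_num) -> measurable_fun setT g ->
  measurable_fun setT (fun x => lne (g x)).
Proof.
move=> gfin mg; pose r x := fine (g x).
have mr : measurable_fun setT r by exact: measurableT_comp.
rewrite (_ : (fun x => _) =
  fun x => if (r x <= 0) then -oo%E else (ln (r x))%:E); last first.
  by apply/funext => x; rewrite /r -{1}(fineK (gfin x)).
apply: measurable_fun_ifT => //.
- exact: measurable_fun_ler.
- by apply/measurable_EFinP; exact: measurableT_comp.
Qed.

End measurable_lne.

Section finite_input.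
Context d d1 d2 (Om : measurableType d) (T1 : measurableType d1)
  (T2 : measurableType d2) (R : realType) (P : probability Om R).
Variables (X : {mfun Om >-> T1}) (Y : {mfun Om >-> T2}) (F : finType)
  (X0 : Om -> F) (h : F -> T1).
Hypotheses (XE : forall o, X o = h (X0 o)) (hI : injective h)
  (mh : forall x, measurable [set h x]).
Variables (rho : {sigma_finite_measure set T2 -> \bar R}) (w : F -> T2 -> R)
  (p : F -> R).
Hypotheses (w0 : forall x y, 0 < w x y)
  (mw : forall x, measurable_fun setT (w x))
  (p0 : forall x, 0 < p x)
  (pE : forall x, P [set o | X0 o = x] = (p x)%:E)
  (wE : forall x B, measurable B ->
    P ([set o | X0 o = x] `&` Y @^-1` B) = (\int[rho]_(y in B) (w x y)%:E)%E).

Local Notation D x := [set o | X0 o = x].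

Lemma measurable_level x : measurable (D x).
Proof.
have -> : D x = X @^-1` [set h x].
  apply/seteqP; split => o /=; first by move=> <-; rewrite XE.
  by rewrite XE => /hI.
by rewrite -[X in measurable X]setTI; exact: (measurable_funPT X).
Qed.

Let mY := measurable_funPT Y.

Lemma integral_finite_input (f : F -> T2 -> \bar R) :
  (forall x, measurable_fun setT (f x)) -> (forall x y, (0 <= f x y)%E) ->
  (\int[P]_o f (X0 o) (Y o) = \sum_x \int[rho]_y (f x y * (w x y)%:E))%E.
Proof.
move=> mf f0.
have fE o : f (X0 o) (Y o) = (\sum_x f x (Y o) * (\1_(D x) o)%:E)%E.
  rewrite (bigD1 (X0 o))//= indicE mem_set// mule1 big1 ?adde0// => x /eqP xX.
  by rewrite indicE memNset ?mule0// => /esym.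
under eq_integral do rewrite fE.
have mfD x : measurable_fun setT (fun o => f x (Y o) * (\1_(D x) o)%:E)%E.
  apply: emeasurable_funM; first exact: (measurableT_comp (mf x) mY).
  by apply/measurable_EFinP/measurable_indic; exact: measurable_level.
have fD0 x o : setT o -> (0 <= f x (Y o) * (\1_(D x) o)%:E)%E.
  by rewrite mule_ge0// lee_fin.
rewrite ge0_integral_sum//; apply: eq_bigr => x _.
rewrite -(integral_slice P (measurable_level x))//.
apply: integral_density => // A mA.
rewrite -wE// setIC; by [].
Qed.

Lemma measurable_ind_pair x :
  measurable_fun setT (fun z : T1 * T2 => \1_[set h x] z.1 : R).
Proof. by apply: measurableT_comp => //; exact: measurable_indic. Qed.

Let m y := \sum_x w x y.

Let mm : measurable_fun setT m. Proof. exact: measurable_sum. Qed.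

Let mgt0 x y : w x y <= m y.
Proof.
by rewrite /m (bigD1 x)//= lerDl sumr_ge0// => x' _; exact: ltW.
Qed.

Let m0 (x : F) y : 0 < m y. Proof. exact: lt_le_trans (w0 x y) (mgt0 x y). Qed.

Lemma integral_input (phi : T1 -> \bar R) : measurable_fun setT phi ->
  (forall t, (0 <= phi t)%E) ->
  (\int[distribution P X]_t phi t = \sum_x phi (h x) * (p x)%:E)%E.
Proof.
move=> mphi phi0; rewrite ge0_integral_distribution//.
have := integral_finite_input (f := fun x _ => phi (h x)).
move=> /(_ (fun=> measurable_cst _) (fun _ _ => phi0 _)) E.
apply: etrans (etrans E _); first by apply: eq_integral => o _ /=; rewrite XE.
apply: eq_bigr => x _.
rewrite ge0_integralZl//; last 2 first.
- by apply/measurable_EFinP.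
- by move=> y _; rewrite lee_fin ltW.
by rewrite -wE// preimage_setT setIT pE.
Qed.

Lemma integral_output (g : T2 -> \bar R) : measurable_fun setT g ->
  (forall y, (0 <= g y)%E) ->
  (\int[distribution P Y]_y g y = \int[rho]_y (g y * (m y)%:E))%E.
Proof.
move=> mg g0; rewrite ge0_integral_distribution//.
apply: (etrans (integral_finite_input (f := fun _ => g) (fun=> mg) (fun=> g0))).
rewrite -ge0_integral_sum//.
- apply: eq_integral => y _; rewrite /m -sumEFin ge0_sume_distrr//.
  by move=> x _; rewrite lee_fin ltW.
- move=> x; apply: emeasurable_funM => //; exact/measurable_EFinP.
- by move=> x y _; rewrite mule_ge0// lee_fin ltW.
Qed.

(* the density of the joint law with respect to the product of the marginals *)
Let f (z : T1 * T2) : R := \sum_x \1_[set h x] z.1 * (w x z.2 / (p x * m z.2)).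

Let f_h x y : f (h x, y) = w x y / (p x * m y).
Proof.
rewrite /f (bigD1 x)//= indicE mem_set// mul1r big1 ?addr0// => x' x'x.
rewrite indicE memNset ?mul0r//= => /hI xx'.
by rewrite xx' eqxx in x'x.
Qed.

Let mf : measurable_fun setT f.
Proof.
apply: measurable_sum => x; apply: measurable_funM; first exact: measurable_ind_pair.
(* Measurability of the quotient: the denominator is positive, so its inverse is [expR (- ln _)]. *)
have -> : (fun z : T1 * T2 => w x z.2 / (p x * m z.2)) =
    (fun y => w x y * expR (- ln (p x * m y))) \o snd.
  apply/funext => z /=; rewrite expRN lnK// posrE mulr_gt0//; exact: m0.
apply: measurableT_comp => //; apply: measurable_funM => //.
apply: measurableT_comp => //; apply: measurable_funN.
by apply: measurableT_comp => //; exact: measurable_funM.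
Qed.

Let f0 z : 0 <= f z.
Proof.
apply: sumr_ge0 => x _; rewrite mulr_ge0//= ?divr_ge0 ?mulr_ge0 ?ltW//.
exact: m0.
Qed.

Local Notation mu := (distribution P (pairing X Y)).
Local Notation nu := (distribution P X \x distribution P Y)%E.

Lemma joint_density A : measurable A -> mu A = (\int[nu]_(z in A) (f z)%:E)%E.
Proof.
move=> mA.
have -> : mu A = (\int[P]_o (\1_A (h (X0 o), Y o))%:E)%E.
  transitivity (\int[mu]_z (\1_A z)%:E)%E; first by rewrite integral_indic// setIT.
  rewrite ge0_integral_distribution//; last first.
    by apply/measurable_EFinP; exact: measurable_indic.
  by apply: eq_integral => o _ /=; rewrite /pairing XE.
have mhp x : measurable_fun setT (fun y : T2 => (h x, y)).
  exact: measurable_fun_pair.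
have mA1 x : measurable_fun setT (fun y => (\1_A (h x, y))%:E : \bar R).
  have mI : measurable_fun setT (\1_A : T1 * T2 -> R) by exact: measurable_indic.
  by apply/measurable_EFinP; exact: (measurableT_comp mI (mhp x)).
have A0 x y : (0 <= (\1_A (h x, y))%:E :> \bar R)%E by rewrite lee_fin.
apply: (etrans (integral_finite_input mA1 A0)).
rewrite integral_mkcond epatch_indic fubini_tonelli1; first last.
- by move=> z; rewrite /= mule_ge0// lee_fin.
- apply: emeasurable_funM; apply/measurable_EFinP => //; exact: measurable_indic.
have mfA : measurable_fun setT (fun z => ((EFin \o f) \* (EFin \o \1_A)) z)%E.
  apply: emeasurable_funM; apply/measurable_EFinP => //; exact: measurable_indic.
rewrite integral_input; first last.
- by move=> t; apply: integral_ge0 => y _; rewrite mule_ge0// lee_fin.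
- apply: measurable_fun_fubini_tonelli_F => //.
  by move=> z; rewrite mule_ge0// lee_fin.
apply: eq_bigr => x _; rewrite /fubini_F integral_output; first last.
- by move=> y; rewrite mule_ge0// lee_fin.
- exact: (measurableT_comp mfA (mhp x)).
rewrite -ge0_integralZr//; first last.
- by rewrite lee_fin ltW.
- by move=> y _; rewrite !mule_ge0// lee_fin// ltW// (m0 x).
- apply: emeasurable_funM; first exact: (measurableT_comp mfA (mhp x)).
  exact/measurable_EFinP.
apply: eq_integral => y _ /=; rewrite f_h -!EFinM; congr EFin.
by have := m0 x y; have := p0 x => p0x m0y; field; rewrite !gt_eqF.
Qed.

Lemma dominates_joint : mu `<< nu.
Proof.
apply/null_content_dominatesP => A mA A0; rewrite joint_density//.
by apply: null_set_integral => //; apply: measurable_funTS; exact/measurable_EFinP.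
Qed.

Let nuP : probability (T1 * T2)%type R := (distribution P X \x distribution P Y)%E.

Let RN := Radon_Nikodym (charge_of_finite_measure mu) nuP.

Lemma joint_Radon_Nikodym : ae_eq mu setT RN (EFin \o f).
Proof.
have dom : mu `<< nuP := dominates_joint.
have E : ae_eq nuP setT RN (EFin \o f).
  apply: integral_ae_eq => //.
  - exact: Radon_Nikodym_integrable.
  - exact/measurable_EFinP.
  - move=> A _ mA; rewrite -Radon_Nikodym_integral//.
    exact: joint_density.
exact: null_dominates_ae_eq dom E.
Qed.

Let g x y : R := ln (m y) - ln (w x y).

Let mg x : measurable_fun setT (g x).
Proof. by apply: measurable_funB; exact: measurableT_comp. Qed.

Let g0 x y : 0 <= g x y.
Proof. by rewrite subr_ge0 ler_ln ?posrE ?w0 ?(m0 x). Qed.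

(** This is what makes the conditional entropy finite: the output density [m] has finite integral.
    It is [xlnx_ge] at [w x y] and [m y]. *)
Let gw x y : g x y * w x y <= m y.
Proof.
rewrite /g mulrBl mulrC [ln (w x y) * _]mulrC lerBlDr.
have := xlnx_ge (w0 x y) (m0 x y); have := w0 x y; lra.
Qed.

Let integral_w x : (\int[rho]_y (w x y)%:E = (p x)%:E)%E.
Proof. by rewrite -wE// preimage_setT setIT pE. Qed.

Let integral_g : (\int[P]_o (g (X0 o) (Y o))%:E
  = \int[rho]_y (ent (w ^~ y))%:E)%E.
Proof.
have mgE x : measurable_fun setT (fun y => (g x y)%:E) by exact/measurable_EFinP.
have g0E x y : (0 <= (g x y)%:E)%E by rewrite lee_fin.
rewrite (integral_finite_input mgE g0E) -ge0_integral_sum//.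
- apply: eq_integral => y _; rewrite entE -sumEFin; apply: eq_bigr => x _.
  by rewrite -EFinM mulrC.
- by move=> x; apply: emeasurable_funM => //; exact/measurable_EFinP.
- by move=> x y _; rewrite mule_ge0// lee_fin ltW.
Qed.

Lemma integral_ent_lty : (\int[rho]_y (ent (w ^~ y))%:E < +oo)%E.
Proof.
have mgE x : measurable_fun setT (fun y => (g x y)%:E) by exact/measurable_EFinP.
have g0E x y : (0 <= (g x y)%:E)%E by rewrite lee_fin.
rewrite -integral_g (integral_finite_input mgE g0E).
apply: lte_sum_pinfty => x _.
apply: (@le_lt_trans _ _ (\int[rho]_y (m y)%:E)%E).
  apply: ge0_le_integral => //.
  - by move=> y _; rewrite mule_ge0// lee_fin ltW.
  - by apply: emeasurable_funM => //; exact/measurable_EFinP.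
  - exact/measurable_EFinP.
  - by move=> y _; rewrite -EFinM lee_fin.
under eq_integral do rewrite -sumEFin.
rewrite ge0_integral_sum//.
- by apply: lte_sum_pinfty => x' _; rewrite integral_w ltry.
- by move=> x'; exact/measurable_EFinP.
- by move=> x' y _; rewrite lee_fin ltW.
Qed.

Let measurable_finite_input (k : F -> T2 -> R) :
  (forall x, measurable_fun setT (k x)) ->
  measurable_fun setT (fun o => k (X0 o) (Y o)).
Proof.
move=> mk.
rewrite (_ : (fun o => _) = fun o => \sum_x k x (Y o) * \1_(D x) o).
  apply: measurable_sum => x; apply: measurable_funM.
    exact: (measurableT_comp (mk x) mY).
  by apply: measurable_indic; exact: measurable_level.
apply/funext => o; rewrite (bigD1 (X0 o))//= indicE mem_set// mulr1.
rewrite big1 ?addr0// => x /eqP xX.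
by rewrite indicE memNset ?mulr0// => /esym.
Qed.

Let integrable_g : P.-integrable setT (fun o => (g (X0 o) (Y o))%:E).
Proof.
apply/integrableP; split.
  by apply/measurable_EFinP; exact: measurable_finite_input.
under eq_integral do rewrite /= ger0_norm//.
by rewrite integral_g integral_ent_lty.
Qed.

Let k x : R := - ln (p x).

Let k0 x : 0 <= k x.
Proof.
rewrite oppr_ge0 ln_le0//.
by rewrite -lee_fin -pE probability_le1//; exact: measurable_level.
Qed.

Let integral_k : (\int[P]_o (k (X0 o))%:E = (- \sum_x p x * ln (p x))%:E)%E.
Proof.
have k0E x (y : T2) : (0 <= (k x)%:E)%E by rewrite lee_fin.
apply: (etrans (integral_finite_input (f := fun x _ => (k x)%:E)
  (fun=> measurable_cst _) k0E)).
rewrite -sumrN -sumEFin; apply: eq_bigr => x _.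
rewrite ge0_integralZl//.
- by rewrite integral_w -EFinM /k mulNr mulrC.
- exact/measurable_EFinP.
- by move=> y _; rewrite lee_fin ltW.
- by rewrite lee_fin.
Qed.

Let integrable_k : P.-integrable setT (fun o => (k (X0 o))%:E).
Proof.
apply/integrableP; split.
  apply/measurable_EFinP.
  exact: (measurable_finite_input (k := fun x _ => k x) (fun=> measurable_cst _)).
under eq_integral do rewrite /= ger0_norm//.
by rewrite integral_k ltry.
Qed.

(** Stated for any dominating measure [rho], so that it serves both the graph, with a counting
    measure, and the channel, with a Gaussian product. The logarithm of the joint density is
    [k - g], the surprise of the label minus its surprise given the output. Both are nonnegative and
    integrable, which allows the integral to be split. *)
Lemma mutual_info_finite_input : mutual_info (P := P) X Y =
  ((- \sum_x p x * ln (p x))%:E - \int[rho]_y (ent (w ^~ y))%:E)%E.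
Proof.
have dom : mu `<< nuP := dominates_joint.
rewrite /mutual_info /relative_entropy; case: asboolP => [_|]; last by [].
have mRN : measurable_fun setT RN by exact: measurable_int (Radon_Nikodym_integrable _).
have RNfin z : RN z \is a fin_num by exact: Radon_Nikodym_fin_num.
have mlf : measurable_fun setT (fun z => lne (f z)%:E).
  by apply: measurable_lne_fin => //; exact/measurable_EFinP.
transitivity (\int[mu]_z lne (f z)%:E)%E.
  apply: ae_eq_integral => //; first exact: measurable_lne_fin.
  have [N [mN N0 RNN]] := joint_Radon_Nikodym.
  exists N; split => //; apply: subset_trans RNN => z /= nz RNz.
  by apply: nz => _; rewrite -/RN RNz.
have lfE : (fun z => lne (f z)%:E) \o pairing X Y =
    (fun o => (k (X0 o))%:E - (g (X0 o) (Y o))%:E)%E.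
  apply/funext => o; rewrite /comp /pairing XE f_h lne_EFin; last first.
    by rewrite divr_gt0 ?w0// mulr_gt0// (m0 (X0 o)).
  rewrite -EFinB; congr EFin; rewrite ln_div ?posrE ?w0 ?mulr_gt0 ?(m0 (X0 o))//.
  by rewrite lnM ?posrE ?(m0 (X0 o))// /k /g; ring.
rewrite integral_distribution//; last by rewrite lfE; exact: integrableB.
by rewrite lfE integralB// integral_k integral_g.
Qed.

End finite_input.

(** * The two models *)

Section tuple_count.
Context (R : realType) (N : nat).
Local Notation T := (N.-tuple bool).

Lemma measurable_set1_tuple d (S : measurableType d) (t : N.-tuple S) :
  (forall a : S, measurable [set a]) -> measurable [set t].
Proof.
move=> m1; have -> : [set t] = rect (fun k => [set tnth t k]).
  apply/seteqP; split => [_ -> k _ //|s st].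
  by apply/eq_from_tnth => k; exact: st.
exact: measurable_rect.
Qed.

Lemma measurable_bool_tuple (A : set T) : measurable A.
Proof.
rewrite (_ : A = \bigcup_(t in A) [set t]); last by rewrite bigcup_imset1 image_id.
apply: fin_bigcup_measurable => // t _.
exact: measurable_set1_tuple.
Qed.

Lemma measurable_fun_bool_tuple d (S : measurableType d) (f : T -> S) :
  measurable_fun setT f.
Proof. by move=> _ B mB; exact: measurable_bool_tuple. Qed.

Lemma measure_bool_tuple (m : {measure set T -> \bar R}) B :
  m B = (\sum_g (\1_B g)%:E * m [set g])%E.
Proof.
rewrite -[B in LHS]setIT -integral_indic//; last exact: measurable_bool_tuple.
under eq_integral => g _.
  rewrite (_ : (\1_B g)%:E = \sum_h ((\1_B h)%:E * (\1_[set h] g)%:E))%E; last first.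
    rewrite (bigD1 g)//= [X in (_ * X%:E)%E]indicE mem_set// mule1.
    rewrite big1 ?adde0// => h hg; rewrite [X in (_ * X%:E)%E]indicE memNset ?mule0//=.
    by move=> gh; rewrite gh eqxx in hg.
  over.
rewrite ge0_integral_sum//.
- apply: eq_bigr => h _; rewrite ge0_integralZl//.
  + by rewrite integral_indic ?setIT//; exact: measurable_bool_tuple.
  + exact: measurable_fun_bool_tuple.
- by move=> h; exact: measurable_fun_bool_tuple.
Qed.

(** The counting measure, as a sum of Dirac masses along the enumeration; the indices stay below its
    length, so the default of [nth] is never reached. *)
Definition tuple_count : set T -> \bar R :=
  msum (fun i => \d_(nth [tuple of nseq N false] (enum {: T}) i)) #|{: T}|.

HB.instance Definition _ := Measure.on tuple_count.

Lemma integral_tuple_count (f : T -> \bar R) : (forall t, (0 <= f t)%E) ->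
  (\int[tuple_count]_t f t = \sum_t f t)%E.
Proof.
move=> f0; rewrite ge0_integral_measure_sum//; last exact: measurable_fun_bool_tuple.
rewrite [RHS](_ : _ = \sum_(t <- enum {: T}) f t)%E; last by rewrite big_enum.
rewrite (big_nth [tuple of nseq N false]) big_mkord.
rewrite [in RHS](_ : size _ = #|{: T}|); last by rewrite cardE.
apply: eq_bigr => i _; rewrite integral_dirac//; last exact: measurable_fun_bool_tuple.
by rewrite diracT mul1e.
Qed.

Let tuple_count_fin : fin_num_fun tuple_count.
Proof.
move=> A mA; rewrite /tuple_count /msum sum_fin_num; apply/allP => x.
by move=> /mapP[i _ ->]; exact: fin_num_measure.
Qed.

HB.instance Definition _ := Measure_isFinite.Build _ _ _ tuple_count tuple_count_fin.

End tuple_count.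

Section labels.
Context (R : realType) (p : R) (hp : 0 < p < 1) (n : nat) (dO : measure_display)
  (Om : measurableType dO) (P : probability Om R).
Variable X : 'I_n -> {RV P >-> bool}.
Hypothesis iidX : iid X (bernoulli_prob p).
Local Notation F := {ffun 'I_n -> bool}.

Lemma bernoulli_prob1 (q : R) b : 0 < q < 1 ->
  bernoulli_prob q [set b] = (bernoulli_pmf q b)%:E.
Proof.
by move=> /andP[q0 q1]; rewrite /bernoulli_prob !ltW//= fsbig_set1.
Qed.

Lemma bernoulli_pmf_gt0 (q : R) b : 0 < q < 1 -> 0 < bernoulli_pmf q b.
Proof. by move=> /andP[q0 q1]; case: b => //=; rewrite /= subr_gt0. Qed.

Definition label_pmf (x : F) : R := \prod_i bernoulli_pmf p (x i).

Lemma label_pmf_gt0 x : 0 < label_pmf x.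
Proof. by apply: prodr_gt0 => i _; exact: bernoulli_pmf_gt0. Qed.

Lemma sum_label_pmf : \sum_x label_pmf x = 1.
Proof.
rewrite -(bigA_distr_bigA (fun _ b => bernoulli_pmf p b)) /= big1// => i _.
by rewrite big_bool /= addrC subrK.
Qed.

Definition labelling (o : Om) : F := [ffun i => X i o].

Lemma labelling_set x :
  [set o | labelling o = x] = [set o | forall i, X i o = x i].
Proof.
apply/seteqP; split => o /=; first by move=> <- i; rewrite ffunE.
by move=> ox; apply/ffunP => i; rewrite ffunE.
Qed.

Lemma prob_labelling x : P [set o | labelling o = x] = (label_pmf x)%:E.
Proof.
rewrite labelling_set; have [ind law] := iidX.
have := ind (fun i => [set x i]) (fun i => I).
rewrite (_ : \bigcap_i _ = [set o | forall i, X i o = x i]); last first.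
  by apply/seteqP; split => o ox i; [exact: ox|move=> _; exact: ox].
move=> ->; rewrite /label_pmf -prodEFin; apply: eq_bigr => i _.
rewrite -bernoulli_prob1//; exact: law.
Qed.

Lemma tuple_enum_inj S (c : bool -> S) : injective c ->
  injective (fun x : F => [tuple c (x (enum_val k)) | k < #|'I_n|]).
Proof.
move=> cI x y xy; apply/ffunP => i; apply: cI.
have := congr1 (fun t => tnth t (enum_rank i)) xy.
by rewrite !tnth_mktuple enum_rankK.
Qed.

End labels.

Arguments label_pmf {R} p {n} x.

Section graph.
Context (R : realType) (p lambda d : R) (hp : 0 < p < 1) (n : nat)
  (dO : measure_display) (Om : measurableType dO) (P : probability Om R).
Variables (X : 'I_n -> {RV P >-> bool}) (G : edge n -> {RV P >-> bool}).
Local Notation F := {ffun 'I_n -> bool}.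
Local Notation N := #|edge n|.

Definition edge_prob (k : 'I_N) (x : F) : R :=
  sbm_matrix p lambda d n (x (val (enum_val k)).1) (x (val (enum_val k)).2).

Hypothesis q01 : forall k x, 0 < edge_prob k x < 1.
Hypothesis model : sbm p lambda d X G.

Definition graph_weight (x : F) (g : N.-tuple bool) : R := label_pmf p x *
  \prod_k (if tnth g k then edge_prob k x else 1 - edge_prob k x).

Lemma graph_weight_gt0 x g : 0 < graph_weight x g.
Proof.
apply: mulr_gt0; first exact: label_pmf_gt0.
apply: prodr_gt0 => k _; have /andP[q0 q1] := q01 k x.
by case: ifP; rewrite ?subr_gt0.
Qed.

Lemma joint_labelling o :
  joint X o = [tuple id (labelling X o (enum_val k)) | k < #|'I_n|].
Proof. by apply: eq_from_tnth => k; rewrite !tnth_mktuple ffunE. Qed.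

Lemma prob_graph_weight x g :
  P ([set o | labelling X o = x] `&` joint G @^-1` [set g]) =
  (graph_weight x g)%:E.
Proof.
have [iidX law] := model.
have := law x (fun e => tnth g (enum_rank e)); rewrite -labelling_set.
rewrite (_ : [set o | forall e, _] = joint G @^-1` [set g]); last first.
  apply/seteqP; split => o /=.
    by move=> oe; apply: eq_from_tnth => k; rewrite tnth_mktuple oe enum_valK.
  by move=> <- e; rewrite tnth_mktuple enum_rankK.
move=> ->; rewrite (prob_labelling hp iidX) /graph_weight EFinM; congr (_ * _)%E.
rewrite -prodEFin (reindex (@enum_val (edge n) (edge n))) /=; last first.
  exact/onW_bij/enum_val_bij.
apply: eq_bigr => k _; rewrite enum_valK bernoulli_prob1//.
exact: (q01 k x).
Qed.

Lemma prob_graph x B : measurable B ->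
  P ([set o | labelling X o = x] `&` joint G @^-1` B) =
  (\int[@tuple_count R N]_(g in B) (graph_weight x g)%:E)%E.
Proof.
have mD : measurable [set o | labelling X o = x].
  rewrite (_ : [set o | labelling X o = x] = \bigcap_i (X i @^-1` [set x i])).
    apply: fin_bigcap_measurable => // i _.
    by rewrite -[Y in measurable Y]setTI; exact: (measurable_funPT (X i)).
  rewrite labelling_set.
  by apply/seteqP; split => o ox i; [move=> _; exact: ox|exact: ox].
move=> _; rewrite setIC -[LHS]/(slice P mD (joint G) B) measure_bool_tuple.
rewrite integral_mkcond epatch_indic integral_tuple_count; last first.
  by move=> g; rewrite /= mule_ge0// lee_fin ltW// graph_weight_gt0.
apply: eq_bigr => g _; rewrite muleC; congr (_ * _)%E.
by rewrite -prob_graph_weight setIC.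
Qed.

Lemma graph_infoE : graph_info X G =
  ((- \sum_(x : F) label_pmf p x * ln (label_pmf p x))%:E
   - (splits edge_prob (@ent R F) (label_pmf p))%:E)%E.
Proof.
have [iidX _] := model.
rewrite /graph_info (@mutual_info_finite_input _ _ _ _ _ _ _ _ _ _ F (labelling X)
  (fun x : F => [tuple id (x (enum_val k)) | k < #|'I_n|]) _ _ _
  (@tuple_count R N) graph_weight (label_pmf p)).
- congr (_ - _)%E; rewrite integral_tuple_count => [|g]; last first.
    by rewrite lee_fin ent_ge0// => x; exact: graph_weight_gt0.
  by rewrite splitsE sumEFin.
- exact: joint_labelling.
- by apply: (tuple_enum_inj (c := id)) => x y.
- by move=> x; exact: measurable_bool_tuple.
- exact: graph_weight_gt0.
- by move=> x; exact: measurable_fun_bool_tuple.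
- exact: label_pmf_gt0.
- exact: prob_labelling.
- exact: prob_graph.
Qed.

End graph.

Section channel.
Context (R : realType) (p lambda : R) (hp : 0 < p < 1) (n : nat)
  (dO : measure_display) (Om : measurableType dO) (P : probability Om R).
Variables (X : 'I_n -> {RV P >-> bool}) (G : edge n -> {RV P >-> bool})
  (Z : edge n -> {RV P >-> R}).
Local Notation F := {ffun 'I_n -> bool}.
Local Notation N := #|edge n|.
Local Notation gamma := (std_normal R).

Definition edge_spin (k : 'I_N) (x : F) : R :=
  phi p (x (val (enum_val k)).1) * phi p (x (val (enum_val k)).2).

Definition edge_mean (k : 'I_N) (x : F) : R :=
  Num.sqrt (lambda / n%:R) * edge_spin k x.

Hypothesis iidX : iid X (bernoulli_prob p).
Hypothesis noise : gaussian_noise X G Z.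

Lemma phi_inj : injective (phi p).
Proof.
have /andP[p0 p1] := hp.
have t0 : 0 < Num.sqrt ((1 - p) / p) by rewrite sqrtr_gt0 divr_gt0// subr_gt0.
have f0 : 0 <= Num.sqrt (p / (1 - p)) by exact: sqrtr_ge0.
by move=> [] []//=; rewrite /phi; lra.
Qed.

Definition channel_weight (x : F) (y : N.-tuple R) : R :=
  label_pmf p x * gliks (edge_mean ^~ x) y.

Lemma joint_spin o : joint (fun i => spin p (X i)) o =
  [tuple phi p (labelling X o (enum_val k)) | k < #|'I_n|].
Proof. by apply: eq_from_tnth => k; rewrite !tnth_mktuple ffunE. Qed.

Lemma law_noise A : measurable A -> P (joint Z @^-1` A) = iidm gamma N A.
Proof.
move=> mA; apply: (@iidm_unique _ _ _ gamma N (distribution P (joint Z))) => // B mB.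
have [[ind law] _] := noise.
have := ind (fun e => B (enum_rank e)) (fun e => mB _).
rewrite (_ : \bigcap_i _ = joint Z @^-1` rect B); last first.
  apply/seteqP; split => o /= oB k _.
    by have := oB (enum_val k) I; rewrite /= enum_valK tnth_mktuple.
  by have := oB (enum_rank k) I; rewrite /= tnth_mktuple enum_rankK.
move=> E; apply: etrans E _.
rewrite (reindex (@enum_val (edge n) (edge n))) /=; last first.
  exact/onW_bij/enum_val_bij.
by apply: eq_bigr => k _; rewrite enum_valK; exact: law.
Qed.

(** On the event that the labelling is [x], the observations are the noise shifted by the
    deterministic vector [edge_mean ^~ x]. Independence factors the probability and the
    Cameron-Martin formula turns the shift into the weight [gliks]. *)
Lemma prob_channel x B : measurable B ->
  P ([set o | labelling X o = x] `&` joint (observation p lambda X Z) @^-1` B) =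
  (\int[iidm gamma N]_(y in B) (channel_weight x y)%:E)%E.
Proof.
move=> mB; have [_ ind] := noise.
have mS : measurable (shift_tuple (edge_mean ^~ x) @^-1` B).
  by rewrite -[Y in measurable Y]setTI; exact: measurable_shift_tuple.
(* Independence of the noise is stated against labels and graph jointly, so the label event is
   written as a rectangle with a full graph side. *)
pose A := [set [tuple id (x (enum_val k)) | k < #|'I_n|]] `*` [set: N.-tuple bool].
have mA : measurable A by apply: measurableX => //; exact: measurable_bool_tuple.
have AE : pairing (joint X) (joint G) @^-1` A = [set o | labelling X o = x].
  apply/seteqP; split => o /=; rewrite /A /= joint_labelling.
    by by case=> /(@tuple_enum_inj n _ id (fun x y => id)).
  by move=> ->.
have indE := ind _ _ mA mS; rewrite AE in indE.
have <- : [set o | labelling X o = x] `&`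
    joint Z @^-1` (shift_tuple (edge_mean ^~ x) @^-1` B) =
    [set o | labelling X o = x] `&` joint (observation p lambda X Z) @^-1` B.
  have E o : labelling X o = x -> shift_tuple (edge_mean ^~ x) (joint Z o)
      = joint (observation p lambda X Z) o.
    move=> <-; apply: eq_from_tnth => k; rewrite !tnth_mktuple.
    by rewrite /observation /edge_mean /edge_spin /spin !ffunE addrC mulrA.
  by apply/seteqP; split => o /= [ox] oB; split => //; move: oB; rewrite E.
rewrite indE (prob_labelling hp iidX) law_noise//.
have ms : measurable_fun setT (EFin \o gliks (edge_mean ^~ x)).
  by apply/measurable_EFinP; exact: measurable_gliks.
have mBi : measurable_fun setT (fun y => (\1_B y)%:E : \bar R).
  by apply/measurable_EFinP; exact: measurable_indic.
rewrite integral_mkcond epatch_indic.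
transitivity ((label_pmf p x)%:E *
  \int[iidm gamma N]_y ((\1_B y)%:E * (gliks (edge_mean ^~ x) y)%:E))%E.
  congr (_ * _)%E; rewrite -integral_iidm_translate//.
  rewrite -[Y in iidm _ _ Y]setIT -integral_indic//.
rewrite -ge0_integralZl//.
- apply: eq_integral => y _; rewrite /= /channel_weight EFinM muleA muleAC.
  by rewrite -muleA.
- exact: emeasurable_funM.
- by move=> y _; rewrite mule_ge0// lee_fin ltW// gliks_gt0.
- by rewrite lee_fin ltW// label_pmf_gt0.
Qed.

Lemma channel_infoE : channel_info p lambda X Z =
  ((- \sum_(x : F) label_pmf p x * ln (label_pmf p x))%:E
   - \int[iidm gamma N]_y (ent (channel_weight ^~ y))%:E)%E.
Proof.
rewrite /channel_info (@mutual_info_finite_input _ _ _ _ _ _ _ _ _ _ F (labelling X)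
  (fun x : F => [tuple phi p (x (enum_val k)) | k < #|'I_n|]) _ _ _
  (iidm gamma N) channel_weight (label_pmf p)) => //.
- exact: joint_spin.
- by apply: tuple_enum_inj; exact: phi_inj.
- by move=> x; exact: measurable_set1_tuple.
- by move=> x y; rewrite mulr_gt0 ?gliks_gt0 ?label_pmf_gt0.
- by move=> x; apply: measurable_funM => //; exact: measurable_gliks.
- exact: label_pmf_gt0.
- exact: prob_labelling.
- exact: prob_channel.
Qed.

End channel.

(** * The comparison *)

Section exchange.
Context (R : realType).

Lemma variance_scale (F : finType) (w s : F -> R) c :
  variance w (fun x => c * s x) = c ^+ 2 * variance w s.
Proof.
rewrite /variance /mean.
rewrite (eq_bigr (fun x => c ^+ 2 * (w x * s x ^+ 2))); last by move=> x _; ring.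
rewrite [\sum_x w x * (c * s x)](eq_bigr (fun x => c * (w x * s x))); last first.
  by move=> x _; ring.
by rewrite -!mulr_sumr; ring.
Qed.

(** By [q * eps ^+ 2 = a ^+ 2] both observations lose [a ^+ 2 * variance w s / 2] to leading order,
    so only the two remainders are left. The point [x0] ensures that the total mass is positive. *)
Lemma close_channels_ent (F : finType) (x0 : F) (s : F -> R) (q eps a K : R) :
  0 < q <= 2^-1 -> 0 <= eps -> eps * K <= 2^-1 -> 0 <= a -> a * K <= 4^-1 ->
  q * eps ^+ 2 = a ^+ 2 -> (forall x, `|s x| <= K) ->
  close_channels
    (2 * (q * (eps * K) ^+ 2 * (2 * (eps * K) + 3 * q)) + 32 * (a * K) ^+ 4)
    (@ent R F) (fun x => q * (1 + eps * s x)) (fun x => a * s x).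
Proof.
move=> q02 eps0 epsK a0 aK qa sK w w0.
have W0 : 0 < \sum_x w x.
  by rewrite (bigD1 x0)//= ltr_pwDl// sumr_ge0// => x _; exact: ltW.
have uK x : `|eps * s x| <= eps * K by rewrite normrM ger0_norm// ler_wpM2l.
have mK x : `|a * s x| <= a * K by rewrite normrM ger0_norm// ler_wpM2l.
have := ent_bern_approx w0 W0 q02 epsK uK.
have /andP[] := ent_gauss_approx w0 W0 aK mK.
rewrite -/(split (@ent R F) (fun x => q * (1 + eps * s x)) w).
rewrite !variance_scale.
have -> : q / 2 * (eps ^+ 2 * variance w s) = a ^+ 2 * variance w s / 2.
  by rewrite -qa; field.
set S := split _ _ _; set W := \sum_x w x; set E := q * _ * _.
set B4 := (a * K) ^+ 4; set V := _ - _ / 2.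
have B40 : 0 <= W * (32 * B4).
  have h : 0 <= B4 by exact: exprn_even_ge0.
  by apply: mulr_ge0; [exact: ltW|lra].
move=> lb ub; rewrite ler_norml => /andP[h1 h2].
have -> : (2 * E + 32 * B4) * W = W * (2 * E) + W * (32 * B4) by ring.
apply/andP; split.
  by apply: le_trans lb; rewrite lee_fin; lra.
by apply: (le_trans ub); rewrite lee_fin; lra.
Qed.

Lemma limn_esup_le_near (u : (\bar R)^nat) (l : \bar R) :
  (\forall n \near \oo, (u n <= l)%E) -> (limn_esup u <= l)%E.
Proof.
move=> [N _ uN]; rewrite limn_esup_lim; apply: lime_le.
  exact: is_cvg_esups.
exists N => // n /= Nn; apply: ge_ereal_sup => _ [k /= nk <-].
by apply: uN; exact: leq_trans nk.
Qed.

End exchange.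

Section model_bounds.
Context (R : realType) (p lambda : R) (hp : 0 < p < 1) (hlambda : 0 < lambda).
Local Notation K := (p^-1 + (1 - p)^-1).

Lemma phiM x y : phi p x * phi p y =
  match x, y with
  | true, true => (1 - p) / p
  | false, false => p / (1 - p)
  | _, _ => -1
  end.
Proof.
have /andP[p0 p1] := hp; have p1' : 0 < 1 - p by rewrite subr_gt0.
have E : Num.sqrt ((1 - p) / p) * Num.sqrt (p / (1 - p)) = 1.
  rewrite -sqrtrM ?divr_ge0 ?ltW// (_ : _ * _ = 1) ?sqrtr1//.
  by field; rewrite !gt_eqF.
case: x y => [] [] /=; rewrite /phi.
- by rewrite -expr2 sqr_sqrtr// divr_ge0 ?ltW.
- by rewrite mulrN E.
- by rewrite mulNr mulrC E.
- by rewrite mulrNN -expr2 sqr_sqrtr// divr_ge0 ?ltW.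
Qed.

(** The three possible products are [p^-1 - 1], [(1 - p)^-1 - 1] and [-1], each at most [K] in
    absolute value. *)
Lemma phiM_le x y : `|phi p x * phi p y| <= K.
Proof.
have /andP[p0 p1] := hp; have p1' : 0 < 1 - p by rewrite subr_gt0.
have ip : 1 <= p^-1 by rewrite invf_ge1// ltW.
have iq : 0 < (1 - p)^-1 by rewrite invr_gt0.
have E1 : (1 - p) / p = p^-1 - 1 by field; rewrite gt_eqF.
have E2 : p / (1 - p) = (1 - p)^-1 - 1 by field; rewrite gt_eqF.
have jq : 1 <= (1 - p)^-1 by rewrite invf_ge1// ler_wnDr// oppr_le0 ltW.
by rewrite phiM; case: x y => [] []; rewrite ler_norml ?E1 ?E2; lra.
Qed.

(** The matrix is a rank-one perturbation of a constant one, along the very spins sent through the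
    Gaussian channel. *)
Lemma sbm_matrixE d n x y : sbm_matrix p lambda d n x y =
  d / n%:R * (1 + Num.sqrt (lambda / d) * (phi p x * phi p y)).
Proof. by rewrite phiM /sbm_matrix; case: x y => [] []; congr (_ * _); ring. Qed.

Lemma card_edge_le n : (#|edge n| <= n ^ 2)%N.
Proof.
by rewrite card_sig (leq_trans (max_card _))// card_prod card_ord expnS expn1.
Qed.

Lemma info_gap (d : R) n (dO : measure_display) (Om : measurableType dO)
    (P : probability Om R) (X : 'I_n -> {RV P >-> bool})
    (G : edge n -> {RV P >-> bool}) (Z : edge n -> {RV P >-> R}) :
  let eps := Num.sqrt (lambda / d) in let a := Num.sqrt (lambda / n%:R) in
  let q := d / n%:R in
  0 < d -> (0 < n)%N -> eps * K <= 2^-1 -> a * K <= 4^-1 -> q <= 2^-1 ->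
  sbm p lambda d X G -> gaussian_noise X G Z ->
  (`| graph_info X G - channel_info p lambda X Z |
   <= (#|edge n|%:R * (2 * (q * (eps * K) ^+ 2 * (2 * (eps * K) + 3 * q))
        + 32 * (a * K) ^+ 4))%:E)%E.
Proof.
move=> eps a q d0 n0 epsK aK q2 model noise.
have [iidX _] := model.
have nR0 : 0 < n%:R :> R by rewrite ltr0n.
have q0 : 0 < q by rewrite divr_gt0.
have eps0 : 0 <= eps by exact: sqrtr_ge0.
have a0 : 0 <= a by exact: sqrtr_ge0.
have K0 : 0 <= K by exact: le_trans (phiM_le true true).
have qE (k : 'I_#|edge n|) x : edge_prob p lambda d k x = q * (1 + eps * edge_spin p k x).
  by rewrite /edge_prob sbm_matrixE.
have sK (k : 'I_#|edge n|) x : `|edge_spin p k x| <= K by exact: phiM_le.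
have q01 (k : 'I_#|edge n|) x : 0 < edge_prob p lambda d k x < 1.
  have : `|eps * edge_spin p k x| <= 2^-1.
    by rewrite normrM ger0_norm// (le_trans _ epsK)// ler_wpM2l.
  by rewrite qE ler_norml => /andP[h1 h2]; apply/andP; split; nra.
set delta := 2 * _ + _.
have delta0 : 0 <= delta.
  have e0 : 0 <= eps * K := mulr_ge0 eps0 K0.
  have h1 : 0 <= q * (eps * K) ^+ 2 * (2 * (eps * K) + 3 * q).
    by apply: mulr_ge0; [apply: mulr_ge0; [exact: ltW|exact: sqr_ge0]|lra].
  have h2 : 0 <= (a * K) ^+ 4 by exact: exprn_even_ge0.
  rewrite /delta; lra.
have cl (k : 'I_#|edge n|) : close_channels delta (@ent R {ffun 'I_n -> bool})
    (edge_prob p lambda d k) (edge_mean p lambda k).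
  rewrite (_ : edge_prob p lambda d k = fun x => q * (1 + eps * edge_spin p k x)).
    apply: close_channels_ent => //; first exact: [ffun=> true].
      by rewrite q0.
    rewrite !sqr_sqrtr ?divr_ge0 ?(ltW hlambda) ?(ltW d0) ?(ltW nR0)//.
    by rewrite /q; field; rewrite !gt_eqF.
  by apply/funext => x; exact: qE.
rewrite (graph_infoE hp q01 model) (channel_infoE lambda hp iidX noise).
set S := splits _ _ _; set J := (\int[_]_t _)%E; set c := _ * delta.
have [lb ub] : (S%:E <= J + c%:E)%E /\ (J <= (S + c)%:E)%E.
  have := interpolation delta0 (admissible_ent _ _) (@label_pmf_gt0 _ _ hp n) q01 cl.
  by rewrite sum_label_pmf mulr1.
(* Finiteness comes from the comparison with the finite sum [S]; it turns the extended-real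
   differences into real ones, where the label entropy cancels. *)
have Jfin : J \is a fin_num.
  rewrite ge0_fin_numE; first by rewrite (le_lt_trans ub)// ltry.
  apply: integral_ge0 => t _; rewrite lee_fin ent_ge0// => x.
  by rewrite mulr_gt0 ?label_pmf_gt0 ?gliks_gt0.
move: lb ub; rewrite -(fineK Jfin) -!EFinB -EFinD !lee_fin => lb ub.
by rewrite ler_norml; apply/andP; split; lra.
Qed.

End model_bounds.

(** Since [d / n * eps ^+ 2 = lambda / n], the cubic Taylor remainder contributes an amount
    independent of [n]. The corrections in [3 * q] and [(a * K) ^+ 4] are smaller by a factor of
    order [1 / n]. *)
Lemma rate_identity (F : fieldType) (n d lambda K eps a : F) :
  n != 0 -> d != 0 -> eps ^+ 2 = lambda / d -> a ^+ 2 = lambda / n ->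
  n^-1 * (n ^+ 2 * (2 * (d / n * (eps * K) ^+ 2 * (2 * (eps * K) + 3 * (d / n)))
    + 32 * (a * K) ^+ 4)) =
  4 * lambda * K ^+ 3 * eps
    + (6 * lambda * K ^+ 2 * d + 32 * lambda ^+ 2 * K ^+ 4) / n.
Proof.
move=> n0 d0 epsE aE; rewrite !exprMn epsE (_ : a ^+ 4 = (a ^+ 2) ^+ 2).
  by rewrite aE; field; rewrite n0 d0.
by rewrite -exprM.
Qed.

Theorem theorem54 (R : realType) (p lambda : R)
    (hp : 0 < p < 1) (hlambda : 0 < lambda) :
  exists2 C : R, 0 < C &
    \forall d \near +oo,
      forall (dO : nat -> measure_display)
        (Om : forall n, measurableType (dO n))
        (P : forall n, probability (Om n) R)
        (X : forall n, 'I_n -> {RV (P n) >-> bool})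
        (G : forall n, edge n -> {RV (P n) >-> bool})
        (Z : forall n, edge n -> {RV (P n) >-> R}),
        (\forall n \near \oo, sbm p lambda d (X n) (G n)) ->
        (\forall n \near \oo, gaussian_noise (X n) (G n) (Z n)) ->
        (limn_esup (fun n => (n%:R^-1)%:E *
            `| graph_info (X n) (G n) - channel_info p lambda (X n) (Z n) |)
         <= (C * Num.sqrt (lambda / d))%:E)%E.
Proof.
have /andP[p0 p1] := hp; have p1' : 0 < 1 - p by rewrite subr_gt0.
set K := p^-1 + (1 - p)^-1.
have K0 : 0 < K by rewrite addr_gt0 ?invr_gt0.
(* Of the 5, the cubic Taylor remainder takes 4; the last unit absorbs the terms in [1 / n], for [n]
   large depending on [d]. *)
exists (5 * lambda * K ^+ 3); first by rewrite !mulr_gt0// exprn_gt0.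
near=> d => dO Om P X G Z model noise.
have d0 : 0 < d by near: d; exact: nbhs_pinfty_gt.
set eps := Num.sqrt (lambda / d).
have eps0 : 0 < eps by rewrite sqrtr_gt0 divr_gt0.
have epsE : eps ^+ 2 = lambda / d by rewrite sqr_sqrtr// divr_ge0// ltW.
have epsK : eps * K <= 2^-1.
  (* This is the square of [eps * K <= 1 / 2], and with [0 < d] the only demand on [d]; it involves
     neither the probability spaces nor [n]. *)
  have : 4 * lambda * K ^+ 2 <= d by near: d; apply: nbhs_pinfty_ge; rewrite num_real.
  move=> dK; rewrite -ler_sqr ?nnegrE ?mulr_ge0 ?(ltW eps0) ?(ltW K0)//.
  rewrite exprMn epsE mulrAC ler_pdivrMr//; lra.
apply: limn_esup_le_near; near=> n.
have modeln : sbm p lambda d (X n) (G n) by near: n.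
have noisen : gaussian_noise (X n) (G n) (Z n) by near: n.
have n1 : 1 <= n%:R :> R by near: n; exact: nbhs_infty_ger.
have nR0 : 0 < n%:R :> R by lra.
have n0 : (0 < n)%N by rewrite -(ltr0n R).
have n2 : 2 * d <= n%:R by near: n; exact: nbhs_infty_ger.
(* This threshold is the square of [a * K <= 1 / 4]; the next one makes the [1 / n] terms at most
   [lambda * K ^+ 3 * eps]. *)
have n3 : 16 * (lambda * K ^+ 2) <= n%:R by near: n; exact: nbhs_infty_ger.
have n4 : (6 * lambda * K ^+ 2 * d + 32 * lambda ^+ 2 * K ^+ 4)
    / (lambda * K ^+ 3 * eps) <= n%:R.
  by near: n; exact: nbhs_infty_ger.
set a := Num.sqrt (lambda / n%:R).
have a0 : 0 <= a by exact: sqrtr_ge0.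
have aE : a ^+ 2 = lambda / n%:R by rewrite sqr_sqrtr// divr_ge0// ltW.
have aK : a * K <= 4^-1.
  rewrite -ler_sqr ?nnegrE ?mulr_ge0 ?(ltW K0)//.
  rewrite exprMn aE mulrAC ler_pdivrMr//; lra.
have q2 : d / n%:R <= 2^-1 by rewrite ler_pdivrMr//; lra.
have := info_gap hp hlambda d0 n0 epsK aK q2 modeln noisen.
set gap := `|_|%E; set D := 2 * _ + _ => gapD.
have D0 : 0 <= D.
  have q0 : 0 <= d / n%:R by rewrite divr_ge0 ?ltW.
  have e0 : 0 <= eps * K by rewrite mulr_ge0 ?ltW.
  have h1 : 0 <= d / n%:R * (eps * K) ^+ 2 * (2 * (eps * K) + 3 * (d / n%:R)).
    apply: mulr_ge0; first by rewrite mulr_ge0// sqr_ge0.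
    by rewrite addr_ge0// mulr_ge0.
  by rewrite addr_ge0// mulr_ge0// exprn_even_ge0.
apply: (@le_trans _ _ ((n%:R^-1)%:E * (#|edge n|%:R * D)%:E)%E).
  by rewrite lee_wpmul2l// lee_fin invr_ge0.
rewrite -EFinM lee_fin.
apply: (@le_trans _ _ (n%:R^-1 * (n%:R ^+ 2 * D))).
  rewrite ler_wpM2l ?invr_ge0// ler_wpM2r// -natrX ler_nat.
  exact: card_edge_le.
have -> : n%:R^-1 * (n%:R ^+ 2 * D) = 4 * lambda * K ^+ 3 * eps
    + (6 * lambda * K ^+ 2 * d + 32 * lambda ^+ 2 * K ^+ 4) / n%:R.
  by apply: rate_identity; rewrite ?gt_eqF.
rewrite (_ : 5 * lambda * K ^+ 3 * eps =
  4 * lambda * K ^+ 3 * eps + lambda * K ^+ 3 * eps); last ring.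
have c0 : 0 < lambda * K ^+ 3 * eps by rewrite !mulr_gt0// exprn_gt0.
by rewrite lerD2l ler_pdivrMr// [leRHS]mulrC -ler_pdivrMr.
Unshelve. all: by end_near.
Qed.
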